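(* Let $d\geq 2$ be an integer and let $d'$ be the smallest even integer greater than $d$. Let $f:\mathbb{R}^n\to\mathbb{R}$ be $d$ times continuously differentiable. Assume that there is a constant $\mu>0$ such that $\nabla^2 f(x)\succeq\mu I$ for all $x\in\mathbb{R}^n$, and that there is a constant $L>0$ such that $\|\nabla^df(y)-\nabla^df(x)\|\leq L\|y-x\|$ for all $x,y\in\mathbb{R}^n$. Let $g_1,\dots,g_m:\mathbb{R}^n\to\mathbb{R}$ be SOS-convex polynomials such that $C:=\{x\in\mathbb{R}^n:g_i(x)\leq 0,\ i=1,\dots,m\}$ has nonempty interior, and let $x^\ast\in C$ be the unique minimizer of $f$ over $C$. Put $r:=\left(\frac{(d-1)!\,\mu}{2L}\right)^{\frac{1}{d-1}}$. Then, for every $x\in\mathbb{R}^n$ satisfying $\|x-x^\ast\|\leq r$, the unique minimizer $x^+$ of $\psi_{x,d}$ over $C$ satisfies $$\|x^{+}-x^{\ast}\|\leq\left(\frac{d'}{2}\right)^{2}\frac{2}{\mu}\left(\frac{L}{d!}+\Big(\max_{\|z-x^{\ast}\|\leq r}t(z)\Big)\,d'\max\{r,1\}\right)\|x-x^{\ast}\|^{d}.$$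
   Context: $\|\cdot\|$ denotes the Euclidean norm on $\mathbb{R}^n$; the norm of a tensor $A\in\mathbb{R}^{n\times\cdots\times n}$ of order $d$ is $\|A\|=\max_{\|u_1\|=\cdots=\|u_d\|=1}|A[u_1,\dots,u_d]|$. A polynomial is a sum of squares (SOS) if it is a finite sum of squares of real polynomials. A polynomial $p:\mathbb{R}^n\to\mathbb{R}$ is SOS-convex if the polynomial $(x,y)\mapsto\langle\nabla^2p(x)y,y\rangle$ on $\mathbb{R}^n\times\mathbb{R}^n$ is SOS. $T_{x,d}(y):=\sum_{k=0}^{d}\frac{1}{k!}\nabla^kf(x)[y-x,\dots,y-x]$ is the $d$th-order Taylor expansion of $f$ at $x$, where $\nabla^k f(x)$ is the symmetric tensor of $k$th-order partial derivatives, applied to $k$ copies of $y-x$. $t(x):=\min\{t\in\mathbb{R}: t\geq 0,\ y\mapsto T_{x,d}(y)+t\|y-x\|^{d'}\text{ is SOS-convex}\}$, and $\psi_{x,d}(y):=T_{x,d}(y)+t(x)\|y-x\|^{d'}$. *)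

(* Defs.v *)
From HB Require Import structures.
From mathcomp Require Import all_boot all_order all_algebra.
From mathcomp Require Import all_classical all_reals all_analysis.
From mathcomp Require mpoly.

Set Implicit Arguments.
Unset Strict Implicit.
Unset Printing Implicit Defensive.

Import Order.TTheory GRing.Theory Num.Theory.
Import numFieldNormedType.Exports.
(* mpoly's notations clash with those of MathComp-Analysis; its canonical
   instances give the ring structure on polynomials. *)
Import (canonicals, coercions) mpoly.

Local Open Scope classical_set_scope.
Local Open Scope ring_scope.

Notation mpolynomial R n := (mpoly.mpoly n R).

Section Extrema.
Context {R : realType}.

(* The value is 0 when the set has no greatest (resp. least) element. *)
Definition set_max (A : set R) : R := xget 0 [set m | A m /\ ubound A m].

Definition set_min (A : set R) : R := xget 0 [set m | A m /\ lbound A m].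

Definition minimizer {T : Type} (f : T -> R) (C : set T) (x : T) : Prop :=
  C x /\ forall y, C y -> f x <= f y.

End Extrema.

Section Euclidean.
Context {R : realType}.

(* The library norm on 'rV[R]_n is the sup norm; it induces the same topology,
   and hence the same interiors, continuity and Frechet derivatives. *)
Definition enorm n (u : 'rV[R]_n) : R := Num.sqrt (\sum_(i < n) u 0 i ^+ 2).

(* A tensor of order d on R^n is given by its n ^ d entries. *)
Definition tensor n d := {ffun d.-tuple 'I_n -> R}.

Definition tensor_app n d (A : tensor n d) (u : 'I_d -> 'rV[R]_n) : R :=
  \sum_(s : d.-tuple 'I_n) A s * \prod_(k < d) u k 0 (tnth s k).

Definition tensor_norm n d (A : tensor n d) : R :=
  set_max [set `|tensor_app A u| | u in
             [set u : 'I_d -> 'rV[R]_n | forall k, enorm (u k) = 1]].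

Definition psdmx n (A : 'M[R]_n) : Prop :=
  forall u : 'rV[R]_n, 0 <= (u *m A *m u^T) 0 0.

End Euclidean.

Section Derivatives.
Context {R : realType} {n : nat}.
Implicit Types (f : 'rV[R]_n -> R) (x y : 'rV[R]_n).

Definition partial (i : 'I_n) f : 'rV[R]_n -> R :=
  fun x => 'D_(delta_mx 0 i : 'rV[R]_n) f x.

Fixpoint Ck (k : nat) f : Prop :=
  if k is k'.+1 then
    (forall x, differentiable f x) /\ forall i, Ck k' (partial i f)
  else continuous f.

Definition nabla (k : nat) f x : tensor n k :=
  [ffun s : k.-tuple 'I_n => foldr partial f s x].

Definition hessian f x : 'M[R]_n :=
  \matrix_(i, j) partial i (partial j f) x.

Definition taylor f (d : nat) x y : R :=
  \sum_(k < d.+1) (k`!%:R)^-1 * tensor_app (nabla k f x) (fun=> y - x).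

End Derivatives.

Section SOS.
Context {R : realType}.

Definition is_sos n (p : mpolynomial R n) : Prop :=
  exists s : seq (mpolynomial R n), p = \sum_(q <- s) q ^+ 2.

(* (x, y) |-> <Hess p(x) y, y>, as a polynomial in n + n variables, of which the
   first n are x and the last n are y. *)
Definition hessian_form n (p : mpolynomial R n) : mpolynomial R (n + n) :=
  let X (k : 'I_(n + n)) : mpolynomial R (n + n) :=
    mpoly.mpolyX R (mpoly.mnm1 k) in
  \sum_(i < n) \sum_(j < n)
    mpoly.comp_mpoly [tuple X (lshift n k) | k < n]
      (mpoly.mderiv i (mpoly.mderiv j p))
    * X (rshift n i) * X (rshift n j).

Definition sos_convex n (g : 'rV[R]_n -> R) : Prop :=
  exists p : mpolynomial R n,
    (forall x, g x = mpoly.meval (x 0) p) /\ is_sos (hessian_form p).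

End SOS.

Section Regularization.
Context {R : realType} {n : nat}.
Variables (f : 'rV[R]_n -> R) (d d' : nat).
Implicit Types (x y : 'rV[R]_n).

Definition regularized_taylor (t : R) x y : R :=
  taylor f d x y + t * enorm (y - x) ^+ d'.

Definition sos_coef x : R :=
  set_min [set t : R | 0 <= t /\ sos_convex (regularized_taylor t x)].

Definition psi x : 'rV[R]_n -> R := regularized_taylor (sos_coef x) x.

End Regularization.

(* Main.v *)
(* Restrict everything to lines. The polynomial psi_x is SOS-convex of degree
   d' = 2k, so along a line [s |-> a + s v] its second derivative is a sum of
   squares of polynomials of degree < k. Such a square satisfies
   q(0)^2 <= k^2 * int_0^1 q^2 (the Christoffel function of [0, 1] at an endpoint
   is 1/k^2), hence the slope of psi_x grows between a and a + v by at least
   psi_x''(a)[v, v] / k^2; this is where (d'/2)^2 comes from. From a = x it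
   follows that psi_x is coercive, so that it has a unique minimiser x+ over C.
   With a = x* and v = x+ - x*, the optimality of x* for f and of x+ for psi_x
   bounds that growth by |v| times the distance between the gradients of f and
   psi_x at x*, while the choice of r keeps the Hessian of psi_x at x* above mu/2;
   both comparisons are Taylor estimates.

   The minimum defining t(z) is attained because sums of squares of bounded degree
   form a closed cone. The maximum of t over the ball is attained because t is
   upper semicontinuous: as the Hessian form of |y|^d' dominates every lower order
   term away from the constant one, and mu |u|^2 controls the constant one, large
   parameters are feasible for all Taylor data in a bounded set. *)

Require Import Defs.
From mathcomp Require Import all_boot all_order all_algebra.
From mathcomp Require Import all_classical all_reals all_analysis.
From mathcomp Require Import ring lra zify.
From mathcomp Require mpoly polyrcf.
Import Order.TTheory GRing.Theory Num.Theory.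
Import numFieldNormedType.Exports.
Import (canonicals, coercions) mpoly.
Local Open Scope classical_set_scope.
Local Open Scope ring_scope.

Set Implicit Arguments.
Unset Strict Implicit.
Unset Printing Implicit Defensive.

(** * Sums of squares in commutative rings *)

(** The minima and maxima of the statement, taken by [set_min] and [set_max], are 0 when they are
    not attained. The coefficient t(x), the tensor norm and the maximum in the conclusion are
    therefore usable only after an attainment proof, which is what the compactness arguments
    provide.

    [psi] is never differentiated as a function on R^n. Its restriction to a line is an explicit
    univariate polynomial, and gradients and Hessians of [psi] appear only as coefficients of it. As
    [f] is only [Ck d] with a Lipschitz last derivative, the Taylor estimates are made for [Dv v f]
    and [Dv v (Dv v f)], which keep d - 1 and d - 2 derivatives.

    Strict convexity of [psi] is not established. Uniqueness of x+ comes from rigidity: a polynomial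
    constant on a segment is constant on the whole line, against coercivity.

    Semicontinuity of t compares Taylor polynomials with different centres. Feasibility is invariant
    under translation and convex in the pair of coefficients and parameter, so a nearby Taylor
    polynomial is an average of the given one and of one with a crude but uniform feasible
    parameter. *)

Definition sos (A : comNzRingType) (p : A) : Prop :=
  exists s : seq A, p = \sum_(q <- s) q ^+ 2.

Section SosRing.
Context {A : comNzRingType}.
Implicit Types p s : A.

Lemma sos0 : sos (0 : A).
Proof. by exists [::]; rewrite big_nil. Qed.

Lemma sos_sqr p : sos (p ^+ 2).
Proof. by exists [:: p]; rewrite big_seq1. Qed.

Lemma sos1 : sos (1 : A).
Proof. by rewrite -(expr1n A 2); exact: sos_sqr. Qed.

Lemma sosD p p' : sos p -> sos p' -> sos (p + p').
Proof. by move=> [s ->] [t ->]; exists (s ++ t); rewrite big_cat. Qed.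

Lemma sosM p p' : sos p -> sos p' -> sos (p * p').
Proof.
move=> [s ->] [t ->]; exists [seq a * b | a <- s, b <- t].
rewrite big_allpairs_dep /= mulr_suml; apply: eq_bigr => a _.
by rewrite mulr_sumr; apply: eq_bigr => b _; rewrite exprMn.
Qed.

Lemma sos_sum (I : Type) (r : seq I) (P : pred I) (F : I -> A) :
  (forall i, P i -> sos (F i)) -> sos (\sum_(i <- r | P i) F i).
Proof. by move=> sF; apply: big_ind => //; [exact: sos0|exact: sosD]. Qed.

Lemma sosX p k : sos p -> sos (p ^+ k).
Proof.
by move=> sp; elim: k => [|k IH]; [exact: sos1|rewrite exprS; exact: sosM].
Qed.

(* [1 + s^(a+b) - s^a - s^b = (1 - s)^2 (1 + ... + s^(a-1)) (1 + ... + s^(b-1))] *)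
Lemma sos_geometric s a b : sos s -> sos (1 + s ^+ (a + b) - s ^+ a - s ^+ b).
Proof.
move=> ss.
have -> : 1 + s ^+ (a + b) - s ^+ a - s ^+ b =
    (s - 1) ^+ 2 * ((\sum_(i < a) s ^+ i) * (\sum_(i < b) s ^+ i)).
  transitivity ((s ^+ a - 1) * (s ^+ b - 1)).
    by rewrite exprD; ring.
  by rewrite !subrX1; ring.
apply: sosM; first exact: sos_sqr.
by apply: sosM; apply: sos_sum => i _; exact: sosX.
Qed.

(** The identity of [sos_geometric] with exponents [m] and [q - m], plus the dropped term
    [s ^+ (q - m)], itself a sum of squares. *)
Lemma sos_exp_le s m q : sos s -> (m <= q)%N -> sos (1 + s ^+ q - s ^+ m).
Proof.
move=> ss mq.
rewrite -[1 + _ - _](subrK (s ^+ (q - m))).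
by apply: sosD; [rewrite -{1}(subnKC mq); exact: sos_geometric|exact: sosX].
Qed.

Section Monomials.
Variables (n : nat) (y : 'I_n -> A).
Let s := \sum_i y i ^+ 2.

Lemma sos_sumsqr : sos s.
Proof. by apply: sos_sum => i _; exact: sos_sqr. Qed.

Lemma sos_sumsqr_le i : sos (s - y i ^+ 2).
Proof.
rewrite /s (bigD1 i) //= addrAC subrr add0r.
by apply: sos_sum => j _; exact: sos_sqr.
Qed.

(** Each [y i ^+ 2] is dominated by [s], so the squared monomial is dominated by [s ^+ size al], and
    that by [1 + s ^+ q]. *)
Lemma sos_monomial_le (al : seq 'I_n) q : (size al <= q)%N ->
  sos (1 + s ^+ q - (\prod_(i <- al) y i) ^+ 2).
Proof.
move=> alq.
have H : sos (s ^+ size al - (\prod_(i <- al) y i) ^+ 2).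
  elim: al {alq} => [|i al IH]; first by rewrite big_nil expr0 expr1n subrr; exact: sos0.
  rewrite big_cons /= exprS.
  set P := \prod_(_ <- _) _ in IH *.
  have -> : s * s ^+ size al - (y i * P) ^+ 2 =
    s * (s ^+ size al - P ^+ 2) + (s - y i ^+ 2) * P ^+ 2 by ring.
  apply: sosD; apply: sosM => //; first exact: sos_sumsqr.
    exact: sos_sumsqr_le.
  exact: sos_sqr.
have := sosD (sos_exp_le sos_sumsqr alq) H.
by rewrite addrA subrK.
Qed.

End Monomials.
End SosRing.

Section SosAlgebra.
Context {R : rcfType} {A : comAlgType R}.
Implicit Types p : A.

Lemma sosZ (c : R) p : 0 <= c -> sos p -> sos (c *: p).
Proof.
move=> c0 sp; rewrite -(mul1r p) scalerAl.
apply: sosM => //; rewrite -(sqr_sqrtr c0).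
have -> : (Num.sqrt c ^+ 2)%:A = ((Num.sqrt c)%:A : A) ^+ 2.
  by rewrite exprZn expr1n.
exact: sos_sqr.
Qed.

Section Bilinear.
Variables (n : nat) (u y : 'I_n -> A).
Let U := \sum_i u i ^+ 2.
Let s := \sum_i y i ^+ 2.

(** A monomial of degree at most 2q splits into two halves of degree at most q. With one [u] factor
    each, their squares are dominated by [U * (1 + s ^+ q)], and the product is controlled by the
    two squares. *)
Lemma sos_bilinear_le (i j : 'I_n) (al : seq 'I_n) q (c : R) :
  (size al <= q + q)%N ->
  sos (`|c| *: (U * (1 + s ^+ q)) + c *: (u i * u j * \prod_(k <- al) y k)).
Proof.
move=> alq; pose a := u i * \prod_(k <- take q al) y k.
pose b := u j * \prod_(k <- drop q al) y k.
have bnd k be : (size be <= q)%N ->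
    sos (U * (1 + s ^+ q) - (u k * \prod_(l <- be) y l) ^+ 2).
  move=> beq; set P := \prod_(_ <- _) _.
  have -> : U * (1 + s ^+ q) - (u k * P) ^+ 2 =
     U * (1 + s ^+ q - P ^+ 2) + (U - u k ^+ 2) * P ^+ 2 by ring.
  apply: sosD; apply: sosM; [exact: sos_sumsqr|exact: sos_monomial_le| |exact: sos_sqr].
  exact: sos_sumsqr_le.
have sa : sos (U * (1 + s ^+ q) - a ^+ 2).
  by apply: bnd; rewrite size_take_min geq_minl.
have sb : sos (U * (1 + s ^+ q) - b ^+ 2).
  by apply: bnd; rewrite size_drop leq_subLR.
have -> : u i * u j * \prod_(k <- al) y k = a * b.
  by rewrite -{1}(cat_take_drop q al) big_cat /= /a /b; ring.
set B := U * _ in sa sb *; set e := a * b.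
(* With [z = a + b] or [z = a - b] this sum is [2 (B + e)] or [2 (B - e)]; the sign of [c] selects
   one. *)
have h (z : A) : sos (B - a ^+ 2 + (B - b ^+ 2) + z ^+ 2).
  by apply: sosD; [exact: sosD|exact: sos_sqr].
have half (z w : A) : 2%:R *: z = w -> sos w -> sos z.
  move=> <- sw; rewrite -[z](@scalerK _ _ 2%:R) ?unitfE ?pnatr_eq0 //.
  by apply: sosZ => //; rewrite invr_ge0 ler0n.
have [c0|c0] := leP 0 c.
  rewrite (ger0_norm c0) -scalerDr; apply: sosZ => //.
  by apply: half (h (a + b)); rewrite scaler_nat /e; ring.
rewrite (ltr0_norm c0) (_ : _ *: _ + _ = - c *: (B - e)); last by rewrite scalerBr !scaleNr opprK.
apply: sosZ; first by rewrite oppr_ge0 ltW.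
by apply: half (h (a - b)); rewrite scaler_nat /e; ring.
Qed.

End Bilinear.

(** [sos_bilinear_le] for [l *: y]: a monomial of degree m picks up [l ^+ m], so the weight on [U]
    drops to [|c| / l ^+ m]. As m is positive this is at most [|c| / l]; the price is [l ^+ (2 * q)]
    on the top-degree term. *)
Lemma sos_bilinear_scaled n (u y : 'I_n -> A) (i j : 'I_n) (al : seq 'I_n) q
    (c l : R) : 1 <= l -> (0 < size al)%N -> (size al <= q + q)%N ->
  sos ((`|c| / l) *: (\sum_i u i ^+ 2) +
       (`|c| * l ^+ (2 * q)) *: ((\sum_i u i ^+ 2) * (\sum_i y i ^+ 2) ^+ q) +
       c *: (u i * u j * \prod_(k <- al) y k)).
Proof.
move=> l1 al0 alq.
have l0 : 0 < l by exact: lt_le_trans l1.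
set U := \sum_i u i ^+ 2; set s := \sum_i y i ^+ 2; set e := _ * \prod_(_ <- _) _.
pose y' k := l *: y k; pose m := size al.
have sU : sos U by exact: sos_sumsqr.
have ss : sos s by exact: sos_sumsqr.
have := sos_bilinear_le u y' i j (c / l ^+ m) alq.
have -> : \sum_i y' i ^+ 2 = l ^+ 2 *: s.
  by rewrite scaler_sumr; apply: eq_bigr => k _; rewrite /y' exprZn.
have -> : \prod_(k <- al) y' k = l ^+ m *: \prod_(k <- al) y k.
  rewrite /m; elim: al {alq al0 e m} => [|k al IH]; first by rewrite !big_nil scale1r.
  by rewrite !big_cons IH /= exprS /y' -scalerAl -scalerAr scalerA.
rewrite -scalerAr scalerA divfK ?expf_neq0 ?gt_eqF // -/e exprZn -exprM.
have lm : 0 <= (l ^+ m)^-1 <= l^-1.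
  apply/andP; split; first by rewrite invr_ge0 exprn_ge0 // ltW.
  by rewrite lef_pV2 ?posrE ?exprn_gt0 // -{1}(expr1 l) ler_weXn2l.
have {}lm1 : 0 <= 1 - (l ^+ m)^-1.
  by case/andP: lm => _ h; rewrite subr_ge0 (le_trans h) // invf_le1.
rewrite normrM (ger0_norm (proj1 (andP lm))) => h.
(* [h1] and [h2] add the differences between the weights in [h] and the simpler ones claimed, which
   do not depend on m. *)
have h1 : sos ((`|c| * (l^-1 - (l ^+ m)^-1)) *: U).
  by apply: sosZ => //; rewrite mulr_ge0 // subr_ge0; case/andP: lm.
have h2 : sos ((`|c| * (1 - (l ^+ m)^-1) * l ^+ (2 * q)) *: (U * s ^+ q)).
  apply: sosZ; last by apply: sosM => //; exact: sosX.
  by rewrite !mulr_ge0 // exprn_ge0 // ltW.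
have := sosD (sosD h1 h2) h; congr sos.
have -> : U * (1 + l ^+ (2 * q) *: s ^+ q) = U + l ^+ (2 * q) *: (U * s ^+ q).
  by rewrite mulrDr mulr1 scalerAr.
rewrite scalerDr scalerA !addrA; congr (_ + _).
rewrite -[LHS]addrA addrACA -(scalerDl U) -(scalerDl (U * s ^+ q)); congr (_ *: _ + _ *: _).
  by rewrite -mulrDr subrK.
by rewrite -mulrDl -mulrDr subrK mulr1.
Qed.

End SosAlgebra.

(** * Integrals of squares of univariate polynomials *)

Section ChristoffelBound.
Context {R : rcfType}.
Implicit Types p q : {poly R}.

(** The integral over [0, 1], term by term. Over a real closed field its positivity follows from the
    mean value theorem for an antiderivative. *)
Definition pint p : R := \sum_(i < size p) p`_i / i.+1%:R.

Lemma pint_widen p m : (size p <= m)%N -> pint p = \sum_(i < m) p`_i / i.+1%:R.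
Proof.
move=> pm; rewrite /pint -(subnKC pm) big_split_ord /= [X in _ = _ + X]big1 ?addr0 //.
by move=> i _; rewrite nth_default ?mul0r // leq_addr.
Qed.

Lemma pintD p q : pint (p + q) = pint p + pint q.
Proof.
set m := maxn (size p) (size q).
rewrite !(@pint_widen _ m) ?leq_maxl ?leq_maxr ?size_polyD //.
by rewrite -big_split; apply: eq_bigr => i _; rewrite coefD mulrDl.
Qed.

Lemma pintZ c p : pint (c *: p) = c * pint p.
Proof.
rewrite !(@pint_widen _ (size p)) ?size_scale_leq // mulr_sumr.
by apply: eq_bigr => i _; rewrite coefZ mulrA.
Qed.

Lemma pint_sum (I : Type) (r : seq I) (P : pred I) (F : I -> {poly R}) :
  pint (\sum_(i <- r | P i) F i) = \sum_(i <- r | P i) pint (F i).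
Proof.
apply: (big_morph pint pintD); rewrite /pint size_poly0 big_ord0 //.
Qed.

Lemma pintXn n : pint 'X^n = n.+1%:R^-1.
Proof.
rewrite (@pint_widen _ n.+1) ?size_polyXn // big_ord_recr /= coefXn eqxx mul1r.
rewrite big1 ?add0r // => i _; rewrite coefXn.
by case: eqP => [e|_]; [have := ltn_ord i; rewrite e ltnn|rewrite mul0r].
Qed.

Lemma size_deriv_le p : (size p^`() <= (size p).-1)%N.
Proof.
have [->|p0] := eqVneq p 0; first by rewrite deriv0 size_poly0.
by have := lt_size_deriv p0; case: (size p).
Qed.

Lemma pint_deriv p : pint p^`() = p.[1] - p.[0].
Proof.
case: (posnP (size p)) => [/eqP|sp].
  by rewrite size_poly_eq0 => /eqP ->; rewrite deriv0 /pint size_poly0 big_ord0 !horner0 subrr.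
rewrite (@pint_widen _ (size p).-1); last exact: size_deriv_le.
rewrite !horner_coef -(prednK sp) !big_ord_recl /= !expr0 !mulr1.
rewrite [X in _ - (_ + X)]big1 ?addr0; last by move=> i _; rewrite expr0n mulr0.
rewrite addrAC subrr add0r; apply: eq_bigr => i _.
by rewrite coef_deriv expr1n mulr1 -[X in X / _]mulr_natr mulfK // pnatr_eq0.
Qed.

Lemma deriv_surj p : exists q, q^`() = p.
Proof.
exists (\poly_(i < (size p).+1) (p`_i.-1 / i%:R)); apply/polyP => i.
rewrite coef_deriv coef_poly ltnS /=; case: ltnP => [_|h].
  by rewrite -[LHS]mulr_natr divfK // pnatr_eq0.
by rewrite mul0rn nth_default.
Qed.

Lemma pint_ge0 p : (forall x, 0 <= p.[x]) -> 0 <= pint p.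
Proof.
move=> p0; have [q qp] := deriv_surj p.
rewrite -qp pint_deriv; have [c _ ->] := polyrcf.poly_mvt q (@ltr01 R).
by rewrite subr0 mulr1 qp.
Qed.

(* [sum_j a_j / (i + j + 1)], as a function of [z = i + 1], is the rational
   function with poles [0, -1, ..., -k] that vanishes at [2, ..., k + 1] and is
   [1] at [1]; its residues are found by Lagrange interpolation. *)
Lemma evaluation_kernel k : exists K : {poly R},
  [/\ (size K <= k.+1)%N, K.[0] = k.+1%:R ^+ 2 &
      forall q, (size q <= k.+1)%N -> pint (K * q) = q.[0]].
Proof.
pose D (j : 'I_k.+1) : {poly R} := \prod_(l < k.+1 | l != j) ('X + l%:R%:P).
pose N : {poly R} := \prod_(i < k) ('X - (i.+2)%:R%:P).
pose P1 : R := \prod_(i < k) i.+1%:R.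
pose P2 : R := \prod_(i < k) i.+2%:R.
have P10 : P1 != 0 by apply/prodf_neq0 => i _; rewrite pnatr_eq0.
have P20 : P2 != 0 by apply/prodf_neq0 => i _; rewrite pnatr_eq0.
have P21 : P2 = k.+1%:R * P1.
  rewrite /P2 /P1; elim: {D N P1 P2 P10 P20} k => [|k IH].
    by rewrite !big_ord0 mulr1.
  by rewrite !big_ord_recr /= IH; ring.
have N1 : N.[1] = (-1) ^+ k * P1.
  rewrite horner_prod -[in (-1) ^+ _](card_ord k) -prodr_const -big_split /=.
  by apply: eq_bigr => i _; rewrite !hornerE; ring.
have N0 : N.[0] = (-1) ^+ k * P2.
  rewrite horner_prod -[in (-1) ^+ _](card_ord k) -prodr_const -big_split /=.
  by apply: eq_bigr => i _; rewrite !hornerE; ring.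
(* [P1] is k! and [P2] is (k+1)!. [A] normalises the rational function to 1 at z = 1, and the
   residue at 0, which is [K.[0]], becomes [(P2 / P1) ^+ 2], that is [k.+1%:R ^+ 2]. *)
pose A : R := P2 / N.[1].
have Djj (j : 'I_k.+1) : (D j).[- j%:R] != 0.
  rewrite horner_prod; apply/prodf_neq0 => l lj; rewrite !hornerE addrC subr_eq0.
  by rewrite eqr_nat.
have Dji (i j : 'I_k.+1) : i != j -> (D j).[- i%:R] = 0.
  by move=> ij; rewrite horner_prod (bigD1 i) //= !hornerE addNr mul0r.
pose a (j : 'I_k.+1) : R := A * N.[- j%:R] / (D j).[- j%:R].
(* Partial fractions: both sides have size at most k + 1 and agree at the k + 1 points 0, -1, ...,
   -k. *)
have E : A *: N = \sum_(j < k.+1) a j *: D j.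
  apply/eqP; rewrite -subr_eq0; apply/eqP.
  apply: (@roots_geq_poly_eq0 _ _ [seq - (val l)%:R | l <- enum 'I_k.+1]).
  - apply/allP => _ /mapP [l _ ->]; rewrite rootE !hornerE horner_sum.
    rewrite (bigD1 l) //= big1 ?addr0; last first.
      by move=> j jl; rewrite !hornerE Dji ?mulr0 // eq_sym.
    by rewrite !hornerE /a divfK // subrr.
  - rewrite map_inj_uniq ?enum_uniq // => i j /oppr_inj /eqP.
    by rewrite eqr_nat => /eqP /val_inj.
  - rewrite size_map size_enum_ord.
    apply: (leq_trans (size_polyD _ _)); rewrite geq_max size_polyN.
    apply/andP; split.
      apply: leq_trans (size_scale_leq _ _) _.
      by rewrite /N -big_enum size_prod_XsubC size_enum_ord.
    apply: leq_trans (size_sum _ _ _) _; apply/bigmax_leqP => j _.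
    apply: leq_trans (size_scale_leq _ _) _.
    apply: leq_trans (size_poly_prod_leq _ _) _.
    rewrite (eq_bigr (fun=> 2%N)) => [|l _]; last by rewrite size_XaddC.
    rewrite sum_nat_const (@eq_card _ _ (predC1 j)) // cardC1 card_ord /=; lia.
pose K : {poly R} := \sum_(j < k.+1) a j *: 'X^j.
have sK : (size K <= k.+1)%N.
  apply: leq_trans (size_sum _ _ _) _; apply/bigmax_leqP => j _.
  by apply: leq_trans (size_scale_leq _ _) _; rewrite size_polyXn.
exists K; split => //.
- rewrite horner_sum big_ord_recl big1 ?addr0; last first.
    by move=> i _; rewrite !hornerE expr0n mulr0.
  rewrite !hornerE /a /= oppr0.
  have -> : (D ord0).[0] = P1.
    rewrite horner_prod big_mkcond big_ord_recl /= mul1r.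
    by apply: eq_bigr => i _; rewrite !hornerE.
  rewrite /A N0 N1 P21 expr2; field.
  by rewrite P10 expf_neq0 // oppr_eq0 oner_neq0.
move=> q sq.
have Di z (j : 'I_k.+1) : (0 < z)%N ->
    (z%:R + j%:R) * (D j).[z%:R] = \prod_(l < k.+1) (z%:R + l%:R) :> R.
  move=> z0; rewrite horner_prod [RHS](bigD1 j) //=; congr (_ * _).
  by apply: eq_bigr => i _; rewrite !hornerE.
have moment (i : 'I_k.+1) : pint (K * 'X^i) = (i == ord0)%:R.
  rewrite /K mulr_suml pint_sum.
  have Pi0 : \prod_(l < k.+1) (i.+1%:R + l%:R) != 0 :> R.
    by apply/prodf_neq0 => l _; rewrite -natrD pnatr_eq0.
  transitivity ((A *: N).[i.+1%:R] / \prod_(l < k.+1) (i.+1%:R + l%:R)).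
    rewrite E horner_sum mulr_suml; apply: eq_bigr => j _.
    rewrite -scalerAl pintZ -exprD pintXn hornerZ -mulrA; congr (_ * _).
    have z0 : (i.+1%:R + j%:R) != 0 :> R by rewrite -natrD pnatr_eq0.
    rewrite -(Di i.+1 j) // invfM mulrCA divff ?mulr1 -?natrD; last first.
      by apply: contraNneq Pi0 => h; rewrite -(Di i.+1 j) // h mulr0.
    by rewrite addSn addnC.
  rewrite hornerZ.
  case: (unliftP ord0 i) => [i' ->|->] /=.
    by rewrite horner_prod (bigD1 i') //= !hornerE /bump /= subrr mulr0 !mul0r.
  transitivity (A * N.[1] / \prod_(l < k.+1) (1 + l%:R)) => //.
  rewrite /A divfK ?N1 ?mulf_neq0 ?expf_neq0 ?oppr_eq0 ?oner_neq0 //.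
  rewrite big_ord_recl /= addr0 mul1r.
  rewrite (_ : \prod_(i < k) _ = P2) ?divff //.
have -> : q = \sum_(i < k.+1) q`_i *: 'X^i.
  rewrite -{1}(coefK q) poly_def -(subnKC sq) big_split_ord /= [X in _ + X]big1 ?addr0 //.
  by move=> i _; rewrite nth_default ?scale0r // leq_addr.
rewrite mulr_sumr pint_sum horner_sum; apply: eq_bigr => i _.
rewrite -scalerAr pintZ moment hornerZ hornerXn expr0n.
by rewrite -(inj_eq val_inj).
Qed.

(** The kernel [K] represents evaluation at 0, hence the integral of [K ^+ 2] is [K.[0]], the square
    of the size bound. The claim is the positivity of the integral of [(q - c *: K) ^+ 2] for the
    optimal [c]. *)
Lemma pint_sqr_ge q k : (size q <= k)%N -> q.[0] ^+ 2 <= k%:R ^+ 2 * pint (q ^+ 2).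
Proof.
case: k => [|k] sq.
  move: sq; rewrite leqn0 size_poly_eq0 => /eqP ->.
  by rewrite horner0 !expr0n mul0r.
have [K [sK K0 Kq]] := evaluation_kernel k.
set k1 : R := k.+1%:R in K0 *.
have k0 : 0 < k1 ^+ 2 by rewrite exprn_gt0 // ltr0Sn.
pose c := q.[0] / k1 ^+ 2.
have : 0 <= pint ((q - c *: K) ^+ 2).
  by apply: pint_ge0 => x; rewrite horner_exp sqr_ge0.
have -> : (q - c *: K) ^+ 2 = q ^+ 2 + (- c * 2) *: (K * q) + c ^+ 2 *: (K * K).
  rewrite -!mul_polyC !polyCM !polyCN polyCM; ring.
rewrite !pintD !pintZ !Kq // K0 -/k1 => h.
rewrite mulrC -ler_pdivrMr //.
have e : q.[0] ^+ 2 / k1 ^+ 2 = c * 2 * q.[0] - c ^+ 2 * k1 ^+ 2.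
  by rewrite /c; field; rewrite nat1r pnatr_eq0.
by rewrite e; lra.
Qed.

(** Leading squares cannot cancel: under a common size bound m + 1 the coefficient of degree 2m of
    the sum is the sum of the squared coefficients of degree m, so it vanishes only if all of them
    do. The bound is lowered one step at a time. *)
Lemma size_sum_sqr (s : seq {poly R}) k :
  (size (\sum_(q <- s) q ^+ 2)%R <= k.*2)%N -> all (fun q : {poly R} => (size q <= k)%N) s.
Proof.
move=> sP.
have step e : all (fun q : {poly R} => (size q <= (k + e).+1)%N) s ->
    all (fun q : {poly R} => (size q <= k + e)%N) s.
  move=> /allP h; set m := (k + e)%N in h *.
  have cf q : q \in s -> (q ^+ 2)`_(m + m) = q`_m ^+ 2.
    move=> /h qm; rewrite expr2 coefM.
    have mm : (m < (m + m).+1)%N by rewrite ltnS leq_addr.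
    rewrite (bigD1 (Ordinal mm)) //= addnK -expr2 big1 ?addr0 // => i im.
    have [lt|gt|eq] := ltngtP i m.
    - by rewrite [X in _ * X]nth_default ?mulr0 //; apply: leq_trans qm _; lia.
    - by rewrite nth_default ?mul0r //; apply: leq_trans qm _.
    - by case/eqP: im; apply: val_inj.
  have : \sum_(q <- s) q`_m ^+ 2 = 0.
    rewrite big_seq -(eq_bigr _ cf) -big_seq -coef_sum nth_default //.
    by apply: leq_trans sP _; rewrite -addnn leq_add // leq_addr.
  move/eqP; rewrite psumr_eq0; last by move=> q _; exact: sqr_ge0.
  move=> /allP z; apply/allP => q qs; apply/leq_sizeP => j.
  rewrite leq_eqVlt => /orP [/eqP <-|mj].
    by have := z q qs; rewrite sqrf_eq0 => /eqP.
  by rewrite nth_default //; apply: leq_trans (h q qs) _.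
have [e he] : exists e, all (fun q : {poly R} => (size q <= k + e)%N) s.
  exists (\max_(q <- s) size q)%N; apply/allP => q qs.
  by apply: leq_trans (leq_addl _ _); exact: leq_bigmax_seq.
by elim: e he => [|e IH]; rewrite ?addn0 // addnS => /step /IH.
Qed.

Lemma deriv_increment_ge (G : {poly R}) (s : seq {poly R}) k :
  (size G <= k.*2.+1)%N -> G^`()^`() = \sum_(q <- s) q ^+ 2 ->
  G^`()^`().[0] <= k%:R ^+ 2 * (G^`().[1] - G^`().[0]).
Proof.
move=> sG Gs.
have /size_sum_sqr /allP sz : (size (\sum_(q <- s) q ^+ 2)%R <= k.*2)%N.
  rewrite -Gs; apply: leq_trans (size_deriv_le _) _; apply: leq_trans (leq_pred _) _.
  by apply: leq_trans (size_deriv_le _) _; move: sG; case: (size G).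
rewrite -pint_deriv Gs pint_sum horner_sum mulr_sumr big_seq [leRHS]big_seq.
by apply: ler_sum => q /sz qk; rewrite horner_exp pint_sqr_ge.
Qed.

End ChristoffelBound.

(** * Hessian forms of multivariate polynomials *)

Section MpolyCalculus.
Context {R : realType} {n : nat}.
Implicit Types p q : mpolynomial R n.

Definition mvar k (i : 'I_k) : mpolynomial R k := mpoly.mpolyX R (mpoly.mnm1 i).

Lemma mpoly_ring_ind (P : mpolynomial R n -> Prop) :
  (forall c, P (mpoly.mpolyC n c)) -> (forall i, P (mvar i)) ->
  (forall p q, P p -> P q -> P (p + q)) ->
  (forall p q, P p -> P q -> P (p * q)) -> forall p, P p.
Proof.
move=> PC PX PD PM p; rewrite (mpoly.mpolyE p).
have P0 : P 0 by have := PC 0; rewrite mpoly.mpolyC0.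
have P1 : P 1 by have := PC 1; rewrite mpoly.mpolyC1.
apply: (big_ind P) => // m _; rewrite -mpoly.mul_mpolyC; apply: (PM) => //.
rewrite mpoly.mpolyXE_id; apply: (big_ind P) => // i _.
have Pe k : P (mvar i ^+ k).
  by elim: k => [|k IH]; rewrite ?expr0 // exprS; apply: (PM).
exact: Pe.
Qed.

Definition mlift : mpolynomial R n -> mpolynomial R (n + n) :=
  mpoly.comp_mpoly [tuple mvar (lshift n k) | k < n].

Definition udir (i : 'I_n) : mpolynomial R (n + n) := mvar (rshift n i).

(** Introduced for the product rule [hessian_formM], whose cross term is twice a product of two
    gradient forms. *)
Definition gradient_form p : mpolynomial R (n + n) :=
  \sum_i mlift (mpoly.mderiv i p) * udir i.

Lemma hessian_formE p : hessian_form p =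
  \sum_i \sum_j mlift (mpoly.mderiv i (mpoly.mderiv j p)) * udir i * udir j.
Proof. by []. Qed.

Lemma mliftD : {morph mlift : p q / p + q}.
Proof. by move=> p q; rewrite /mlift rmorphD. Qed.

Lemma mliftM : {morph mlift : p q / p * q}.
Proof. by move=> p q; rewrite /mlift rmorphM. Qed.

Lemma mlift_var i : mlift (mvar i) = mvar (lshift n i).
Proof. by rewrite /mlift /mvar mpoly.comp_mpolyXU -tnth_nth tnth_mktuple. Qed.

Lemma mliftC (c : R) : mlift (mpoly.mpolyC n c) = mpoly.mpolyC (n + n) c.
Proof. by rewrite /mlift mpoly.comp_mpolyC. Qed.

Lemma mderiv_var (i j : 'I_n) :
  mpoly.mderiv i (mvar j) = (i == j)%:R :> mpolynomial R n.
Proof.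
rewrite /mvar mpoly.mderivX mpoly.mnm1E eq_sym.
have [->|_] := eqVneq i j; last by rewrite scale0r.
suff -> : mpoly.mnm_sub (mpoly.mnm1 j) (mpoly.mnm1 j) = mpoly.mnm0 by rewrite mpoly.mpolyX0 scale1r.
by apply/mpoly.mnmP => k; rewrite mpoly.mnmBE subnn mpoly.mnm0E.
Qed.

Lemma gradient_formD p q : gradient_form (p + q) = gradient_form p + gradient_form q.
Proof.
rewrite /gradient_form -big_split; apply: eq_bigr => i _.
by rewrite mpoly.mderivD mliftD mulrDl.
Qed.

Lemma gradient_formM p q :
  gradient_form (p * q) = gradient_form p * mlift q + mlift p * gradient_form q.
Proof.
rewrite /gradient_form mulr_suml mulr_sumr -big_split; apply: eq_bigr => i _ /=.
by rewrite mpoly.mderivM mliftD !mliftM; ring.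
Qed.

Lemma gradient_formC (c : R) : gradient_form (mpoly.mpolyC n c) = 0.
Proof.
rewrite /gradient_form big1 // => i _.
by rewrite mpoly.mderivC -mpoly.mpolyC0 mliftC mpoly.mpolyC0 mul0r.
Qed.

Lemma mlift_nat (k : nat) : mlift k%:R = k%:R.
Proof. by rewrite /mlift rmorph_nat. Qed.

Lemma gradient_form_var i : gradient_form (mvar i) = udir i.
Proof.
rewrite /gradient_form (bigD1 i) //= big1 => [|j ji].
  by rewrite mderiv_var eqxx mlift_nat mul1r addr0.
by rewrite mderiv_var (negbTE ji) mlift_nat mul0r.
Qed.

Lemma hessian_formD p q : hessian_form (p + q) = hessian_form p + hessian_form q.
Proof.
rewrite !hessian_formE -big_split; apply: eq_bigr => i _ /=.
rewrite -big_split; apply: eq_bigr => j _ /=.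
by rewrite !mpoly.mderivD mliftD !mulrDl.
Qed.

Lemma hessian_formZ c p : hessian_form (c *: p) = c *: hessian_form p.
Proof.
rewrite !hessian_formE scaler_sumr; apply: eq_bigr => i _ /=.
rewrite scaler_sumr; apply: eq_bigr => j _ /=.
by rewrite !mpoly.mderivZ /mlift linearZ /= -!scalerAl.
Qed.

Lemma hessian_formM p q : hessian_form (p * q) =
  hessian_form p * mlift q + 2 * gradient_form p * gradient_form q +
  mlift p * hessian_form q.
Proof.
have e1 : gradient_form p * gradient_form q = \sum_i \sum_j
    mlift (mpoly.mderiv i p) * mlift (mpoly.mderiv j q) * udir i * udir j.
  rewrite /gradient_form mulr_suml; apply: eq_bigr => i _.
  by rewrite mulr_sumr; apply: eq_bigr => j _; ring.
have e2 : gradient_form p * gradient_form q = \sum_i \sum_j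
    mlift (mpoly.mderiv j p) * mlift (mpoly.mderiv i q) * udir i * udir j.
  rewrite [LHS]e1 [LHS]exchange_big; apply: eq_bigr => i _ /=.
  by apply: eq_bigr => j _; ring.
rewrite -mulrA mulr_natl mulr2n {1}e1 e2 !hessian_formE mulr_suml mulr_sumr.
rewrite -!big_split; apply: eq_bigr => i _ /=.
rewrite mulr_suml mulr_sumr -!big_split; apply: eq_bigr => j _ /=.
rewrite mpoly.mderivM mpoly.mderivD !mpoly.mderivM !mliftD !mliftM; ring.
Qed.

Lemma hessian_formC (c : R) : hessian_form (mpoly.mpolyC n c) = 0.
Proof.
rewrite hessian_formE big1 // => i _; rewrite big1 // => j _.
by rewrite !mpoly.mderivC /mlift rmorph0 !mul0r.
Qed.

Lemma hessian_form_var (i : 'I_n) : hessian_form (mvar i : mpolynomial R n) = 0.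
Proof.
rewrite hessian_formE big1 // => j _; rewrite big1 // => k _.
rewrite mderiv_var -mpoly.mpolyC_nat mpoly.mderivC.
by rewrite /mlift rmorph0 !mul0r.
Qed.

Lemma hessian_form_sum (I : Type) (r : seq I) (P : pred I) (F : I -> mpolynomial R n) :
  hessian_form (\sum_(i <- r | P i) F i) = \sum_(i <- r | P i) hessian_form (F i).
Proof.
apply: (big_morph (@hessian_form R n) hessian_formD).
by have := hessian_formC 0; rewrite mpoly.mpolyC0.
Qed.

Definition line_mpoly (a v : 'I_n -> R) : mpolynomial R n -> {poly R} :=
  mpoly.mmap polyC (fun i => (a i)%:P + v i *: 'X).

(** The substitution putting the line into the position variables and its constant velocity into the
    direction variables; it sends the Hessian form to the second derivative along the line. *)
Definition line_mpoly2 (a v : 'I_n -> R) : mpolynomial R (n + n) -> {poly R} :=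
  mpoly.mmap polyC (fun k => match fintype.split k with
    | inl i => (a i)%:P + v i *: 'X | inr i => (v i)%:P end).

Lemma line_mpolyD a v : {morph line_mpoly a v : p q / p + q}.
Proof. by move=> p q; rewrite /line_mpoly rmorphD. Qed.

Lemma line_mpolyM a v : {morph line_mpoly a v : p q / p * q}.
Proof. by move=> p q; rewrite /line_mpoly rmorphM. Qed.

Lemma line_mpolyC a v c : line_mpoly a v (mpoly.mpolyC n c) = c%:P.
Proof. by rewrite /line_mpoly mpoly.mmapC. Qed.

Lemma line_mpoly_var a v i : line_mpoly a v (mvar i) = (a i)%:P + v i *: 'X.
Proof. by rewrite /line_mpoly /mvar mpoly.mmapX mpoly.mmap1U. Qed.

Lemma line_mpoly_eval a v p s :
  (line_mpoly a v p).[s] = mpoly.meval (fun i => a i + s * v i) p.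
Proof.
elim/mpoly_ring_ind: p => [c|i|p q IHp IHq|p q IHp IHq].
- by rewrite line_mpolyC hornerC mpoly.mevalC.
- by rewrite line_mpoly_var !hornerE /mvar mpoly.mevalXU mulrC.
- by rewrite line_mpolyD hornerD IHp IHq mpoly.mevalD.
- by rewrite line_mpolyM hornerM IHp IHq mpoly.mevalM.
Qed.

Lemma line_mpoly_deriv a v p : (line_mpoly a v p)^`() =
  \sum_i (v i)%:P * line_mpoly a v (mpoly.mderiv i p).
Proof.
elim/mpoly_ring_ind: p => [c|i|p q IHp IHq|p q IHp IHq].
- rewrite line_mpolyC derivC big1 // => i _.
  by rewrite mpoly.mderivC /line_mpoly rmorph0 mulr0.
- rewrite line_mpoly_var derivD derivC derivZ derivX add0r (bigD1 i) //= big1.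
    by rewrite mderiv_var eqxx /line_mpoly rmorph1 mulr1 addr0 alg_polyC.
  by move=> j ji; rewrite mderiv_var (negbTE ji) /line_mpoly rmorph0 mulr0.
- rewrite line_mpolyD derivD IHp IHq -big_split; apply: eq_bigr => i _ /=.
  by rewrite mpoly.mderivD line_mpolyD mulrDr.
- rewrite line_mpolyM derivM IHp IHq mulr_suml mulr_sumr -big_split.
  apply: eq_bigr => i _ /=.
  by rewrite mpoly.mderivM line_mpolyD !line_mpolyM; ring.
Qed.

Lemma line_mpoly2_lift a v p : line_mpoly2 a v (mlift p) = line_mpoly a v p.
Proof.
elim/mpoly_ring_ind: p => [c|i|p q IHp IHq|p q IHp IHq].
- by rewrite mliftC line_mpolyC /line_mpoly2 mpoly.mmapC.
- rewrite mlift_var line_mpoly_var /line_mpoly2 /mvar mpoly.mmapX mpoly.mmap1U.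
  by rewrite (unsplitK (inl i)).
- by rewrite mliftD line_mpolyD -IHp -IHq /line_mpoly2 rmorphD.
- by rewrite mliftM line_mpolyM -IHp -IHq /line_mpoly2 rmorphM.
Qed.

Lemma line_mpoly_deriv2 a v p :
  (line_mpoly a v p)^`()^`() = line_mpoly2 a v (hessian_form p).
Proof.
rewrite line_mpoly_deriv raddf_sum /= hessian_formE exchange_big /line_mpoly2 rmorph_sum.
have ur i : mpoly.mmap polyC (fun k => match fintype.split k with
    | inl i => (a i)%:P + v i *: 'X | inr i => (v i)%:P end) (udir i) = (v i)%:P.
  by rewrite /udir /mvar mpoly.mmapX mpoly.mmap1U (unsplitK (inr i)).
rewrite /=; apply: eq_bigr => j _.
rewrite derivM derivC mul0r add0r line_mpoly_deriv mulr_sumr.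
rewrite rmorph_sum; apply: eq_bigr => i _.
rewrite !rmorphM /= !ur -/(line_mpoly2 a v _) line_mpoly2_lift.
ring.
Qed.

(** [line_mpoly2] is a ring morphism, so it carries a sum of squares of multivariate polynomials to
    one of univariate polynomials. *)
Lemma sos_convex_line (g : 'rV[R]_n -> R) (a v : 'rV[R]_n) : sos_convex g ->
  exists (G : {poly R}) (s : seq {poly R}),
    (forall t, g (a + t *: v) = G.[t]) /\ G^`()^`() = \sum_(q <- s) q ^+ 2.
Proof.
move=> [p [gp [s ps]]].
exists (line_mpoly (a 0) (v 0) p), (map (line_mpoly2 (a 0) (v 0)) s); split.
  move=> t; rewrite gp line_mpoly_eval; apply: mpoly.meval_eq => i.
  by rewrite !mxE.
rewrite line_mpoly_deriv2 ps /line_mpoly2 rmorph_sum big_map.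
by apply: eq_bigr => q _; rewrite rmorphXn.
Qed.

End MpolyCalculus.

(** * Nonnegative quadratic forms as sums of squares *)

Section QuadraticForms.
Context {R : rcfType}.

Definition qform (A : comAlgType R) n (Q : 'I_n -> 'I_n -> R) (u : 'I_n -> A) : A :=
  \sum_i \sum_j Q i j *: (u i * u j).

(* One step of Lagrange's reduction; the junk value [b / 0 = 0] is harmless as
   [b = 0] when [Q ord0 ord0 = 0]. *)
Lemma qform_recl (A : comAlgType R) n (Q : 'I_n.+1 -> 'I_n.+1 -> R) (u : 'I_n.+1 -> A) :
  let a := Q ord0 ord0 in
  let b i := (Q ord0 (lift ord0 i) + Q (lift ord0 i) ord0) / 2 in
  let u' i := u (lift ord0 i) in
  (a = 0 -> forall i, b i = 0) ->
  qform Q u = a *: (u ord0 + \sum_i (b i / a) *: u' i) ^+ 2 +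
    qform (fun i j => Q (lift ord0 i) (lift ord0 j) - b i * b j / a) u'.
Proof.
move=> a b u' ab; set w := \sum_i _.
have ba i : a * (b i / a) = b i.
  have [a0|a0] := eqVneq a 0; first by rewrite (ab a0) a0 !mul0r.
  by rewrite mulrCA divff ?mulr1.
have aw : a *: w = \sum_i b i *: u' i.
  by rewrite scaler_sumr; apply: eq_bigr => i _; rewrite scalerA ba.
have aww : a *: (w * w) = \sum_i \sum_j (b i * b j / a) *: (u' i * u' j).
  rewrite scalerAl aw /w mulr_suml; apply: eq_bigr => i _.
  rewrite mulr_sumr; apply: eq_bigr => j _.
  by rewrite -scalerAl -scalerAr scalerA mulrA.
have -> : a *: (u ord0 + w) ^+ 2 =
    a *: (u ord0 * u ord0) + (u ord0 * (a *: w)) *+ 2 + a *: (w * w).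
  rewrite -scalerAr scalerMnr -!scalerDr; congr (_ *: _); ring.
have -> : (u ord0 * (a *: w)) *+ 2 =
    \sum_i (Q ord0 (lift ord0 i) + Q (lift ord0 i) ord0) *: (u ord0 * u' i).
  rewrite aw mulr_sumr -sumrMnl; apply: eq_bigr => i _.
  rewrite -scalerAr scalerMnl; congr (_ *: _).
  by rewrite -mulr_natr divfK ?pnatr_eq0.
rewrite aww /qform big_ord_recl big_ord_recl /= -!addrA; congr (_ + _).
under [X in _ + X = _]eq_bigr do rewrite big_ord_recl /=.
rewrite big_split /= [LHS]addrA; congr (_ + _).
  rewrite -big_split; apply: eq_bigr => i _ /=.
  by rewrite (mulrC (u (lift ord0 i))) -scalerDl.
rewrite -big_split; apply: eq_bigr => i _ /=; rewrite -big_split.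
by apply: eq_bigr => j _ /=; rewrite -scalerDl addrC subrK.
Qed.

Lemma sos_qform (A : comAlgType R) n (Q : 'I_n -> 'I_n -> R) (u : 'I_n -> A) :
  (forall x : 'I_n -> R^o, 0 <= qform Q x :> R) -> sos (qform Q u).
Proof.
elim: n Q u => [|n IH] Q u Qpos; first by rewrite /qform big_ord0; exact: sos0.
set a := Q ord0 ord0.
pose b i := (Q ord0 (lift ord0 i) + Q (lift ord0 i) ord0) / 2.
have qE (x0 : R^o) (x : 'I_n -> R^o) :
    qform Q (fun i => if unlift ord0 i is Some j then x j else x0) =
    a * x0 ^+ 2 + x0 * (\sum_i b i * x i) * 2 +
    qform (fun i j => Q (lift ord0 i) (lift ord0 j)) x :> R.
  rewrite /qform big_ord_recl big_ord_recl /= unlift_none -!addrA; congr (_ + _).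
  under [X in _ + X = _]eq_bigr do rewrite big_ord_recl /= unlift_none.
  rewrite big_split /= [LHS]addrA; congr (_ + _).
    rewrite mulr_sumr mulr_suml -big_split; apply: eq_bigr => i _ /=.
    by rewrite liftK /b /GRing.scale /=; field.
  apply: eq_bigr => i _ ; apply: eq_bigr => j _ /=.
  by rewrite !liftK.
have a0 : 0 <= a.
  have := Qpos _; move=> /(_ (fun i => if unlift ord0 i is Some j then 0 else 1)).
  rewrite qE expr1n mulr1 [X in _ + X]big1 ?addr0 => [|i _]; last first.
    by rewrite big1 // => j _; rewrite mulr0 scaler0.
  by rewrite big1 ?mulr0 ?mul0r ?addr0 // => i _; rewrite mulr0.
have ab : a = 0 -> forall i, b i = 0.
  move=> az i; apply/eqP; apply: contraT => bi.
  pose e : 'I_n -> R^o := fun j => (j == i)%:R.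
  set c := qform (fun i j => Q (lift ord0 i) (lift ord0 j)) e : R.
  (* With [a = 0] the form takes the value [- (c + 1) + c = - 1] at this point. *)
  have := Qpos (fun k => if unlift ord0 k is Some j then e j else - ((c + 1) / (2 * b i))).
  rewrite qE az mul0r add0r -/c (bigD1 i) //= big1 ?addr0; last first.
    by move=> j ji; rewrite /e (negbTE ji) mulr0.
  rewrite /e eqxx mulr1.
  have -> : - ((c + 1) / (2 * b i)) * b i * 2 = - (c + 1).
    by field; rewrite ?pnatr_eq0 /= ?bi.
  by lra.
rewrite qform_recl //; apply: sosD; first by apply: sosZ => //; exact: sos_sqr.
apply: IH => x.
(* This first coordinate annihilates the completed square, so only the reduced form is left. *)
have := Qpos (fun k => if unlift ord0 k is Some j then x j else - \sum_i b i / a * x i).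
rewrite qform_recl // unlift_none.
set w := \sum_i _; set w' := \sum_i _.
have -> : - w + w' = 0.
  rewrite addrC; apply/eqP; rewrite subr_eq0; apply/eqP/eq_bigr => i _.
  by rewrite liftK.
rewrite expr0n scaler0 add0r; congr (0 <= _).
by apply: eq_bigr => i _; apply: eq_bigr => j _; rewrite !liftK.
Qed.

End QuadraticForms.

(** * Regularised Taylor polynomials are SOS-convex for large parameters *)

Lemma big_tuple_recl (V : nmodType) (T : finType) k (F : k.+1.-tuple T -> V) :
  \sum_s F s = \sum_i \sum_(s : k.-tuple T) F [tuple of i :: s].
Proof.
rewrite pair_big /= (reindex (fun p : T * k.-tuple T => [tuple of p.1 :: p.2])) //=.
exists (fun s => (thead s, [tuple of behead s])) => [[i s]|s] _ /=.
  by rewrite theadE; congr (_, _); apply: val_inj.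
by rewrite -tuple_eta.
Qed.

Lemma big_tuple0 (V : nmodType) (T : finType) (F : 0.-tuple T -> V) :
  \sum_s F s = F [tuple].
Proof. by rewrite (big_pred1 [tuple]) // => s; apply/esym/eqP; rewrite tuple0. Qed.

Section StrictFeasibility.
Context {R : realType} {n : nat}.

Definition svar (z : 'rV[R]_n) (i : 'I_n) : mpolynomial R n :=
  mvar i - mpoly.mpolyC n (z 0 i).

Definition ydir (z : 'rV[R]_n) (i : 'I_n) : mpolynomial R (n + n) := mlift (svar z i).

Definition form_mpoly k (A : tensor n k) z : mpolynomial R n :=
  \sum_(s : k.-tuple 'I_n) A s *: \prod_(i <- s) svar z i.

Definition taylor_mpoly d (A : forall k, tensor n k) z : mpolynomial R n :=
  \sum_(k < d.+1) (k`!%:R)^-1 *: form_mpoly (A k) z.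

Definition sqn_mpoly (z : 'rV[R]_n) : mpolynomial R n := \sum_i svar z i ^+ 2.

Lemma meval_svar z i (x : 'rV[R]_n) : mpoly.meval (x 0) (svar z i) = (x - z) 0 i.
Proof. by rewrite /svar rmorphB /= /mvar mpoly.mevalXU mpoly.mevalC !mxE. Qed.

Lemma meval_form k (A : tensor n k) z (x : 'rV[R]_n) :
  mpoly.meval (x 0) (form_mpoly A z) = tensor_app A (fun=> x - z).
Proof.
rewrite /form_mpoly raddf_sum; apply: eq_bigr => s _ /=.
rewrite mpoly.mevalZ rmorph_prod /= big_tuple; congr (_ * _).
by apply: eq_bigr => i _; rewrite meval_svar.
Qed.

Lemma meval_taylor d (A : forall k, tensor n k) z (x : 'rV[R]_n) :
  mpoly.meval (x 0) (taylor_mpoly d A z) =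
  \sum_(k < d.+1) (k`!%:R)^-1 * tensor_app (A k) (fun=> x - z).
Proof.
rewrite /taylor_mpoly raddf_sum; apply: eq_bigr => k _ /=.
by rewrite mpoly.mevalZ meval_form.
Qed.

Lemma enorm_sqr (u : 'rV[R]_n) : enorm u ^+ 2 = \sum_i u 0 i ^+ 2.
Proof. by rewrite sqr_sqrtr // sumr_ge0 // => i _; exact: sqr_ge0. Qed.

Lemma meval_sqn z (x : 'rV[R]_n) :
  mpoly.meval (x 0) (sqn_mpoly z) = enorm (x - z) ^+ 2.
Proof.
rewrite enorm_sqr /sqn_mpoly raddf_sum; apply: eq_bigr => i _ /=.
by rewrite rmorphXn /= meval_svar.
Qed.

Lemma gradient_svar z i : gradient_form (svar z i) = udir i.
Proof.
by rewrite /svar -mpoly.mpolyCN gradient_formD gradient_form_var gradient_formC addr0.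
Qed.

Lemma hessian_svar z i : hessian_form (svar z i) = 0.
Proof.
by rewrite /svar -mpoly.mpolyCN hessian_formD hessian_form_var hessian_formC addr0.
Qed.

(* The pair [(i, t)] stands for [u_i * prod_(j <- t) y_j], and below the triple
   [(i, j, t)] stands for [u_i * u_j * prod_(l <- t) y_l]. *)
Fixpoint gterms (s : seq 'I_n) : seq ('I_n * seq 'I_n) :=
  if s is i :: s' then (i, s') :: [seq (t.1, i :: t.2) | t <- gterms s'] else [::].

Fixpoint hterms (s : seq 'I_n) : seq ('I_n * 'I_n * seq 'I_n) :=
  if s is i :: s' then
    [seq (i, t.1, t.2) | t <- gterms s'] ++ [seq (i, t.1, t.2) | t <- gterms s'] ++
    [seq (t.1, i :: t.2) | t <- hterms s'] else [::].

Lemma size_gterms s t : t \in gterms s -> (size t.2).+1 = size s.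
Proof.
elim: s t => //= i s IH t; rewrite inE => /orP [/eqP -> //|/mapP [t' /IH h ->]] /=.
by rewrite h.
Qed.

Lemma size_hterms s t : t \in hterms s -> (size t.2).+2 = size s.
Proof.
elim: s t => //= i s IH t; rewrite !mem_cat => /or3P [] /mapP [t' h ->] /=.
- by rewrite (size_gterms h).
- by rewrite (size_gterms h).
- by rewrite (IH _ h).
Qed.

Lemma mlift_prod_svar z (s : seq 'I_n) :
  mlift (\prod_(i <- s) svar z i) = \prod_(i <- s) ydir z i.
Proof. by rewrite /mlift rmorph_prod. Qed.

Lemma gradient_prod z s : gradient_form (\prod_(i <- s) svar z i) =
  \sum_(t <- gterms s) udir t.1 * \prod_(i <- t.2) ydir z i.
Proof.
elim: s => [|i s IH].
  by rewrite !big_nil -mpoly.mpolyC1 gradient_formC.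
rewrite big_cons gradient_formM IH gradient_svar mlift_prod_svar /= big_cons big_map.
congr (_ + _); rewrite mulr_sumr; apply: eq_bigr => t _ /=.
by rewrite big_cons mulrCA.
Qed.

Lemma hessian_prod z s : hessian_form (\prod_(i <- s) svar z i) =
  \sum_(t <- hterms s) udir t.1.1 * udir t.1.2 * \prod_(i <- t.2) ydir z i.
Proof.
elim: s => [|i s IH].
  by rewrite !big_nil -mpoly.mpolyC1 hessian_formC.
rewrite big_cons hessian_formM IH hessian_svar gradient_svar mul0r add0r.
rewrite gradient_prod /= !big_cat !big_map /= addrA; congr (_ + _).
  rewrite -mulrA mulr_natl mulr2n mulr_sumr.
  by congr (_ + _); apply: eq_bigr => t _ /=; rewrite mulrA.
rewrite mulr_sumr; apply: eq_bigr => t _ /=.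
by rewrite big_cons mulrCA.
Qed.

Definition unorm2 : mpolynomial R (n + n) := \sum_i udir i ^+ 2.
Definition ynorm2 z : mpolynomial R (n + n) := \sum_i ydir z i ^+ 2.

Lemma sos_unorm2 : sos unorm2. Proof. exact: sos_sumsqr. Qed.
Lemma sos_ynorm2 z : sos (ynorm2 z). Proof. exact: sos_sumsqr. Qed.

Lemma mlift_sqn z : mlift (sqn_mpoly z) = ynorm2 z.
Proof. by rewrite /mlift rmorph_sum; apply: eq_bigr => i _; rewrite rmorphXn. Qed.

Lemma mliftX (p : mpolynomial R n) k : mlift (p ^+ k) = mlift p ^+ k.
Proof. exact: rmorphXn. Qed.

Lemma hessian_sqn z : hessian_form (sqn_mpoly z) = 2 * unorm2.
Proof.
rewrite /sqn_mpoly hessian_form_sum mulr_sumr; apply: eq_bigr => i _.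
by rewrite expr2 hessian_formM hessian_svar gradient_svar mul0r mulr0 add0r addr0 mulrA.
Qed.

Lemma gradient_sqnX z k : gradient_form (sqn_mpoly z ^+ k) =
  k%:R * ynorm2 z ^+ k.-1 * gradient_form (sqn_mpoly z).
Proof.
elim: k => [|k IH]; first by rewrite expr0 -mpoly.mpolyC1 gradient_formC !mul0r.
rewrite exprS gradient_formM IH mliftX mlift_sqn.
case: k {IH} => [|k]; first by rewrite !expr0 !mul0r mulr0 addr0 !mulr1 mul1r.
by rewrite /= -[k.+2%:R]natr1 exprS; ring.
Qed.

(** In the recursion [rec] given by the product rule all terms are sums of squares, and the first
    contains two copies of [unorm2 * ynorm2 z ^+ q]. Giving up one copy leaves a sum of squares. *)
Lemma sos_hessian_sqnX_ge z q :
  sos (hessian_form (sqn_mpoly z ^+ q.+1) - unorm2 * ynorm2 z ^+ q).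
Proof.
have s2 k : sos (k%:R : mpolynomial R (n + n)).
  elim: k => [|k IH]; first exact: sos0.
  by rewrite mulrS; apply: sosD => //; exact: sos1.
have sy k : sos (ynorm2 z ^+ k) by apply: sosX; exact: sos_ynorm2.
have rec k : hessian_form (sqn_mpoly z ^+ k.+1) = 2 * unorm2 * ynorm2 z ^+ k +
    2 * k%:R * ynorm2 z ^+ k.-1 * gradient_form (sqn_mpoly z) ^+ 2 +
    ynorm2 z * hessian_form (sqn_mpoly z ^+ k).
  rewrite exprS hessian_formM gradient_sqnX hessian_sqn mlift_sqn mliftX mlift_sqn.
  congr (_ + _ + _); ring.
have s1 k : sos (2 * k%:R * ynorm2 z ^+ k.-1 * gradient_form (sqn_mpoly z) ^+ 2).
  apply: sosM; last exact: sos_sqr.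
  by apply: sosM => //; apply: sosM; exact: s2.
have sH k : sos (hessian_form (sqn_mpoly z ^+ k)).
  elim: k => [|k IH]; first by rewrite expr0 -mpoly.mpolyC1 hessian_formC; exact: sos0.
  rewrite rec; apply: sosD; last by apply: sosM => //; exact: sos_ynorm2.
  apply: sosD => //; apply: sosM => //; apply: sosM; first exact: (s2 2%N).
  exact: sos_unorm2.
have -> : hessian_form (sqn_mpoly z ^+ q.+1) - unorm2 * ynorm2 z ^+ q =
    unorm2 * ynorm2 z ^+ q +
    2 * q%:R * ynorm2 z ^+ q.-1 * gradient_form (sqn_mpoly z) ^+ 2 +
    ynorm2 z * hessian_form (sqn_mpoly z ^+ q) by rewrite rec; ring.
apply: sosD; first by apply: sosD => //; apply: sosM => //; exact: sos_unorm2.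
by apply: sosM => //; exact: sos_ynorm2.
Qed.

(* Rescaling [y] by a large factor makes the mixed terms negligible against
   [|u|^2 (1 + |y|^(2q))]. *)
Lemma sos_perturbation_le z (s : seq 'I_n) q (c b l : R) :
  1 <= l -> `|c| <= b -> (2 < size s)%N -> (size s <= (q + q).+2)%N ->
  sos ((b * (size (hterms s))%:R / l) *: unorm2 +
       (b * (size (hterms s))%:R * l ^+ (2 * q)) *: (unorm2 * ynorm2 z ^+ q) +
       c *: hessian_form (\prod_(i <- s) svar z i)).
Proof.
move=> l1 cb s2 sq.
have l0 : 0 < l by exact: lt_le_trans l1.
have sU := sos_unorm2; have sUY : sos (unorm2 * ynorm2 z ^+ q).
  by apply: sosM => //; apply: sosX; exact: sos_ynorm2.
suff H : sos ((`|c| * (size (hterms s))%:R / l) *: unorm2 +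
       (`|c| * (size (hterms s))%:R * l ^+ (2 * q)) *: (unorm2 * ynorm2 z ^+ q) +
       c *: hessian_form (\prod_(i <- s) svar z i)).
  have h1 : sos (((b - `|c|) * (size (hterms s))%:R / l) *: unorm2).
    by apply: sosZ => //; rewrite divr_ge0 ?mulr_ge0 ?subr_ge0 // ltW.
  have h2 : sos (((b - `|c|) * (size (hterms s))%:R * l ^+ (2 * q)) *: (unorm2 * ynorm2 z ^+ q)).
    by apply: sosZ => //; rewrite !mulr_ge0 ?subr_ge0 ?exprn_ge0 // ltW.
  have := sosD (sosD h1 h2) H; congr sos.
  rewrite addrA; congr (_ + _); rewrite addrACA -(scalerDl unorm2) -(scalerDl (unorm2 * _)).
  congr (_ *: _ + _ *: _); ring.
rewrite hessian_prod.
(* The induction runs over sublists of [hterms s]: membership is what keeps the degree of [t.2]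
   between 1 and 2q. *)
have : {subset hterms s <= hterms s} by [].
elim: {-2}(hterms s) => [|t ts IH] sub.
  by rewrite big_nil scaler0 addr0 /= !mulr0 !mul0r !scale0r addr0; exact: sos0.
rewrite big_cons /=.
have st := size_hterms (sub t (mem_head _ _)).
have h1 : sos ((`|c| / l) *: unorm2 +
    (`|c| * l ^+ (2 * q)) *: (unorm2 * ynorm2 z ^+ q) +
    c *: (udir t.1.1 * udir t.1.2 * \prod_(k <- t.2) ydir z k)).
  by move: s2 sq; rewrite -st !ltnS => s2 sq; exact: sos_bilinear_scaled.
have {}IH := IH (fun x h => sub x (mem_behead (s := t :: ts) h)).
have := sosD h1 IH; congr sos.
rewrite addrACA -scalerDr; congr (_ + _).
rewrite addrACA -(scalerDl unorm2) -(scalerDl (unorm2 * _)) -[(size ts).+1%:R]nat1r.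
by congr (_ *: _ + _ *: _); ring.
Qed.

Lemma tensor_app2 (A : tensor n 2) (u : 'rV[R]_n) : tensor_app A (fun=> u) =
  \sum_i \sum_j A [tuple i; j] * (u 0 i * u 0 j).
Proof.
rewrite /tensor_app big_tuple_recl; apply: eq_bigr => i _.
rewrite big_tuple_recl; apply: eq_bigr => j _.
rewrite big_tuple0 !big_ord_recl big_ord0 mulr1.
by congr (A _ * _); apply: val_inj.
Qed.

Lemma hessian_form2 (A : tensor n 2) z : hessian_form (form_mpoly A z) =
  2%:R *: qform (fun i j => A [tuple i; j]) udir.
Proof.
rewrite /form_mpoly hessian_form_sum big_tuple_recl /qform scaler_sumr.
apply: eq_bigr => i _; rewrite big_tuple_recl scaler_sumr; apply: eq_bigr => j _.
rewrite big_tuple0 hessian_formZ hessian_prod /= !big_cons !big_nil mulr1 addr0.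
rewrite -mulr2n -[X in _ *: X]scaler_nat !scalerA mulrC.
by congr (_ * A _ *: _); apply: val_inj.
Qed.

Lemma sos_hessian2 (A : tensor n 2) z mu :
  (forall u : 'rV[R]_n, mu * enorm u ^+ 2 <= tensor_app A (fun=> u)) ->
  sos (2^-1 *: hessian_form (form_mpoly A z) - mu *: unorm2).
Proof.
move=> Amu; rewrite hessian_form2 scalerA mulVf ?pnatr_eq0 // scale1r.
pose Q i j := A [tuple i; j] - mu * (i == j)%:R.
have QE (V : comAlgType R) (u : 'I_n -> V) : qform Q u =
    qform (fun i j => A [tuple i; j]) u - mu *: \sum_i u i ^+ 2.
  rewrite scaler_sumr /qform -sumrB; apply: eq_bigr => i _.
  rewrite [in RHS](bigD1 i) //= [LHS](bigD1 i) //= /Q eqxx mulr1 scalerBl -expr2.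
  rewrite addrAC; congr (_ + _ - _); apply: eq_bigr => j ji.
  by rewrite [i == j]eq_sym (negbTE ji) mulr0 subr0.
rewrite -QE; apply: sos_qform => x.
rewrite QE subr_ge0; have := Amu (\row_i x i).
rewrite tensor_app2 enorm_sqr => h.
have -> : qform (fun i j => A [tuple i; j]) x =
    \sum_i \sum_j A [tuple i; j] * ((\row_i x i) 0 i * (\row_i x i) 0 j).
  by apply: eq_bigr => i _; apply: eq_bigr => j _; rewrite !mxE.
apply: le_trans h; rewrite le_eqVlt; apply/orP; left; apply/eqP; congr (_ * _).
by apply: eq_bigr => i _; rewrite !mxE.
Qed.

(** The threshold [T] depends on the tensors only through [mu] and [B]. This uniformity is what
    [sos_coef_usc] relies on. *)
Lemma sos_hessian_taylor d q (mu B : R) : 0 < mu -> 0 <= B ->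
    (2 <= d)%N -> (d <= (q + q).+2)%N ->
  exists2 T : R, 0 <= T & forall z (A : forall k, tensor n k) t,
    (forall u : 'rV[R]_n, mu * enorm u ^+ 2 <= tensor_app (A 2) (fun=> u)) ->
    (forall k (s : k.-tuple 'I_n), (k <= d)%N -> `|A k s| <= B) -> T <= t ->
    sos (hessian_form (taylor_mpoly d A z + t *: sqn_mpoly z ^+ q.+1)).
Proof.
move=> mu0 B0 d2 dq.
pose m k := \sum_(s : k.-tuple 'I_n) B * (size (hterms s))%:R.
pose M := \sum_(k < d.+1) m k.
have m0 k : 0 <= m k by apply: sumr_ge0 => s _; rewrite mulr_ge0.
have M0 : 0 <= M by exact: sumr_ge0.
(* The terms of order above two together borrow [M / l] times [unorm2]. This [l] makes that at most
   [mu], the amount supplied by the second-order term. *)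
pose l := 1 + M / mu.
have l1 : 1 <= l by rewrite lerDl divr_ge0 // ltW.
have l0 : 0 < l by exact: lt_le_trans l1.
have Ml : M / l <= mu.
  rewrite ler_pdivrMr // /l mulrDr mulr1 mulrCA divff ?gt_eqF // mulr1.
  by rewrite lerDr ltW.
exists (M * l ^+ (2 * q)); first by rewrite mulr_ge0 // exprn_ge0 // ltW.
move=> z A t A2 AB Tt.
set U := unorm2; set V := unorm2 * ynorm2 z ^+ q.
have sU : sos U := sos_unorm2.
have sV : sos V by apply: sosM => //; apply: sosX; exact: sos_ynorm2.
pose F k := (k`!%:R)^-1 *: hessian_form (form_mpoly (A k) z).
have FE k : F k = \sum_(s : k.-tuple 'I_n) (A k s / k`!%:R) *:
    hessian_form (\prod_(i <- s) svar z i).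
  rewrite /F /form_mpoly hessian_form_sum scaler_sumr; apply: eq_bigr => s _.
  by rewrite hessian_formZ scalerA mulrC.
(* Orders 0 and 1 have no Hessian, order 2 supplies [mu *: U], and the higher orders are
   perturbations. *)
have claim (k : 'I_d.+1) : sos ((m k / l) *: U + (m k * l ^+ (2 * q)) *: V + F k -
    (k == 2 :> nat)%:R *: (mu *: U)).
  have sm : sos ((m k / l) *: U + (m k * l ^+ (2 * q)) *: V).
    by apply: sosD; apply: sosZ => //; rewrite ?divr_ge0 ?mulr_ge0 ?exprn_ge0 // ltW.
  have [k2|k2|k2] := ltngtP k 2.
  - rewrite scale0r subr0 FE [X in _ + X]big1 ?addr0 // => s _.
    rewrite hessian_prod big1_seq ?scaler0 // => t' /andP [_ /size_hterms].
    by rewrite size_tuple => e; move: k2; rewrite -e.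
  - rewrite scale0r subr0 FE /m !mulr_suml !scaler_suml -!big_split.
    apply: sos_sum => s _; apply: sos_perturbation_le; rewrite ?size_tuple //.
      rewrite normrM normfV normr_nat ler_pdivrMr ?ltr0n ?fact_gt0 //.
      apply: le_trans (AB _ _ _) _; first by rewrite -ltnS.
      by rewrite ler_peMr // ler1n fact_gt0.
    by apply: leq_trans dq; rewrite -ltnS.
  - rewrite scale1r -addrA; apply: sosD => //.
    by rewrite /F; move: (k : nat) k2 => _ ->; exact: sos_hessian2.
have h1 : sos ((M / l) *: U + (M * l ^+ (2 * q)) *: V + \sum_(k < d.+1) F k - mu *: U).
  have := @sos_sum _ _ (index_enum _) xpredT _ (fun k _ => claim k).
  rewrite sumrB !big_split /= -!scaler_suml.
  congr (sos (_ - _)).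
  have d2' : (2 < d.+1)%N by [].
  rewrite (bigD1 (Ordinal d2')) //= big1 ?addr0 ?scale1r // => k k2.
  by case: eqP => // e; case/eqP: k2; exact: val_inj.
have h2 : sos ((mu - M / l) *: U) by apply: sosZ => //; rewrite subr_ge0.
have h3 : sos ((t - M * l ^+ (2 * q)) *: V) by apply: sosZ => //; rewrite subr_ge0.
have t0 : 0 <= t by apply: le_trans Tt; rewrite mulr_ge0 // exprn_ge0 // ltW.
have h4 := sosZ t0 (sos_hessian_sqnX_ge z q).
have := sosD (sosD h1 h2) (sosD h3 h4); congr sos.
rewrite hessian_formD hessian_formZ -/V scalerBr.
have -> : hessian_form (taylor_mpoly d A z) = \sum_(k < d.+1) F k.
  by rewrite hessian_form_sum; apply: eq_bigr => k _; rewrite hessian_formZ.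
rewrite !scalerBl.
move: (_ *: U) (mu *: U) (_ *: V) (t *: V) (\sum_k _) (t *: _) => a b c e f g; ring.
Qed.

End StrictFeasibility.

(** * Continuity and compactness *)

Section Compactness.
Context {R : realType}.

Lemma continuous_addr (T : topologicalType) (f g : T -> R) :
  continuous f -> continuous g -> continuous (fun x => f x + g x).
Proof. by move=> cf cg x; apply: cvgD; [exact: cf|exact: cg]. Qed.

Lemma continuous_mulr (T : topologicalType) (f g : T -> R) :
  continuous f -> continuous g -> continuous (fun x => f x * g x).
Proof. by move=> cf cg x; apply: cvgM; [exact: cf|exact: cg]. Qed.

Lemma continuous_cst (T : topologicalType) (c : R) : continuous (fun _ : T => c).
Proof. by move=> x; exact: cvg_cst. Qed.

Lemma continuous_normr (T : topologicalType) (f : T -> R) :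
  continuous f -> continuous (fun x => `|f x|).
Proof. by move=> cf x; apply: cvg_norm; exact: cf. Qed.

Lemma continuous_sumr (T : topologicalType) (I : Type) (r : seq I) (F : I -> T -> R) :
  (forall i, continuous (F i)) -> continuous (fun x => \sum_(i <- r) F i x).
Proof.
move=> cF; elim: r => [|i r IH] x.
  rewrite (_ : (fun _ => _) = fun=> 0); first exact: cst_continuous.
  by apply/funext => y; rewrite big_nil.
rewrite (_ : (fun _ => _) = fun y => F i y + \sum_(j <- r) F j y).
  by apply: cvgD; [exact: cF|exact: IH].
by apply/funext => y; rewrite big_cons.
Qed.

Lemma continuous_prodr (T : topologicalType) (I : Type) (r : seq I) (F : I -> T -> R) :
  (forall i, continuous (F i)) -> continuous (fun x => \prod_(i <- r) F i x).
Proof.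
move=> cF; elim: r => [|i r IH] x.
  rewrite (_ : (fun _ => _) = fun=> 1); first exact: cst_continuous.
  by apply/funext => y; rewrite big_nil.
rewrite (_ : (fun _ => _) = fun y => F i y * \prod_(j <- r) F j y).
  by apply: cvgM; [exact: cF|exact: IH].
by apply/funext => y; rewrite big_cons.
Qed.

Lemma closed_forall (T : topologicalType) (I : Type) (P : I -> set T) :
  (forall i, closed (P i)) -> closed [set x | forall i, P i x].
Proof.
move=> cP; have -> : [set x | forall i, P i x] = \bigcap_(i in setT) P i.
  by apply/seteqP; split => x /= h; [move=> i _; exact: h|move=> i; exact: h].
by apply: closed_bigI => i _.
Qed.

Lemma closed_level_le (T : topologicalType) (f g : T -> R) :
  continuous f -> continuous g -> closed [set x | f x <= g x].
Proof.
move=> cf cg.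
have -> : [set x | f x <= g x] = (fun x => g x - f x) @^-1` [set y | 0 <= y].
  by apply/seteqP; split => x /=; rewrite subr_ge0.
apply: preimage_closed; last exact: closed_ge.
by move=> x _; apply: cvgB; [exact: cg|exact: cf].
Qed.

Lemma closed_level_eq (T : topologicalType) (f g : T -> R) :
  continuous f -> continuous g -> closed [set x | f x = g x].
Proof.
move=> cf cg.
have -> : [set x | f x = g x] = [set x | f x <= g x] `&` [set x | g x <= f x].
  by apply/seteqP; split => x /= => [->//|[h1 h2]]; apply/eqP; rewrite eq_le h1 h2.
by apply: closedI; exact: closed_level_le.
Qed.

Lemma compact_of_bounded_coords n (A : set 'rV[R]_n) B : closed A ->
  (forall v, A v -> forall i, `|v 0 i| <= B) -> compact A.
Proof.
move=> cA bA; apply: bounded_closed_compact => //.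
exists (Num.max 0 B); split; first exact: num_real.
move=> M; rewrite gt_max => /andP [M0 BM] v Av /=; rewrite [leLHS]/Num.norm /= mx_normrE.
apply: bigmax_le => [|[i j] _] /=; first exact: ltW.
by rewrite (ord1 i); apply: le_trans (bA v Av j) (ltW BM).
Qed.

Lemma rV_argmin n (A : set 'rV[R]_n) B (f : 'rV[R]_n -> R) : A !=set0 -> closed A ->
  (forall v, A v -> forall i, `|v 0 i| <= B) -> continuous f ->
  exists2 c, A c & forall v, A v -> f c <= f v.
Proof.
move=> A0 cA bA cf.
have kA : compact A by exact: compact_of_bounded_coords bA.
have [c /set_mem Ac h] := EVT_min_rV A0 kA (continuous_subspaceT cf).
by exists c => // v Av; apply: h; exact: mem_set.
Qed.

End Compactness.

(** * Gram matrices and closedness of the cone of sums of squares *)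

Section Interpolation.
Context {R : realType}.

(** The inverse of the Vandermonde matrix at the nodes 0, ..., D recovers coefficients from
    values. *)
Lemma vandermonde_weights D : exists W : 'I_D.+1 -> 'I_D.+1 -> R,
  forall a b : 'I_D.+1, \sum_(j < D.+1) W a j * j%:R ^+ b = (a == b)%:R.
Proof.
pose V : 'M[R]_D.+1 := Vandermonde D.+1 (\row_(j < D.+1) j%:R).
have uV : V \in unitmx.
  rewrite unitmxE det_Vandermonde unitfE; apply/prodf_neq0 => i _.
  apply/prodf_neq0 => j ij; rewrite !mxE subr_eq0 eqr_nat.
  by apply: contraTneq ij => ->; rewrite ltnn.
exists (fun a j => invmx V j a) => a b.
have := congr1 (fun M : 'M[R]_D.+1 => M b a) (mulmxV uV).
rewrite !mxE eq_sym => <-; apply: eq_bigr => j _.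
by rewrite !mxE mulrC.
Qed.

(** Products of the one-variable weights recover a coefficient from the values on the grid of points
    with coordinates 0, ..., D. *)
Lemma mcoeff_interpolation N D (m : mpoly.multinom N) : (mpoly.mdeg m < D.+1)%N ->
  exists w : {ffun 'I_N -> 'I_D.+1} -> R, forall p : mpolynomial R N,
    (mpoly.mmeasure mpoly.mdeg p <= D.+1)%N ->
    mpoly.mcoeff m p = \sum_j w j * mpoly.meval (fun i => (j i)%:R) p.
Proof.
have [W WE] := vandermonde_weights D.
have bnd (b : mpoly.multinom N) : (mpoly.mdeg b < D.+1)%N -> forall i, (b i < D.+1)%N.
  move=> bD i; apply: leq_ltn_trans bD.
  by rewrite mpoly.mdegE (bigD1 i) //= leq_addr.
move=> /bnd mD; pose m' i := Ordinal (mD i).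
exists (fun j => \prod_i W (m' i) (j i)) => p pD.
rewrite {1}(mpoly.mpolyE p) raddf_sum /=.
under [RHS]eq_bigr do rewrite mpoly.mevalE mulr_sumr.
rewrite exchange_big /= big_seq [RHS]big_seq; apply: eq_bigr => b bp.
rewrite mpoly.mcoeffZ mpoly.mcoeffX.
have bD := bnd b (leq_trans (mpoly.msize_mdeg_lt bp) pD).
pose b' i := Ordinal (bD i).
transitivity (mpoly.mcoeff b p * \prod_i (m' i == b' i)%:R).
  congr (_ * _); have [e|mb] := eqVneq b m.
    by rewrite big1 // => i _; rewrite -(inj_eq val_inj) /= e eqxx.
  have [i mbi] : exists i, m i != b i.
    apply/existsP; apply: contraNT mb => /existsPn h; apply/eqP/mpoly.mnmP => i.
    by apply/esym/eqP; have := h i; rewrite negbK.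
  by rewrite (bigD1 i) //= -(inj_eq val_inj) /= (negbTE mbi) mul0r.
under eq_bigr do rewrite -WE.
rewrite bigA_distr_bigA mulr_sumr; apply: eq_bigr => j _.
by rewrite big_split /= mulrCA.
Qed.

Lemma meval_inj N (p q : mpolynomial R N) :
  (forall x : 'rV[R]_N, mpoly.meval (x 0) p = mpoly.meval (x 0) q) -> p = q.
Proof.
move=> pq; apply/eqP; rewrite -subr_eq0; apply/eqP/mpoly.mpolyP => m.
set r := p - q; pose D := (mpoly.mdeg m + mpoly.mmeasure mpoly.mdeg r)%N.
have mD : (mpoly.mdeg m < D.+1)%N by rewrite ltnS leq_addr.
have [w wE] := mcoeff_interpolation mD.
rewrite wE ?mpoly.mcoeff0; last by apply: leqW; rewrite leq_addl.
rewrite big1 // => j _; rewrite rmorphB /=.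
have := pq (\row_i (j i)%:R).
rewrite !(@mpoly.meval_eq _ _ ((\row_i (j i)%:R : 'rV[R]_N) 0) (fun i => (j i)%:R)).
  by move=> ->; rewrite subrr mulr0.
all: by move=> i; rewrite mxE.
Qed.

(** Take [p] with the largest leading monomial m. The coefficient of 2m in the sum is the sum of the
    squares of the coefficients of m, positive because of [p]; the monomial order refines the
    degree, so a square of too large degree would show up in the sum. *)
Lemma msize_sum_sqr N D (s : seq (mpolynomial R N)) :
  (mpoly.mmeasure mpoly.mdeg (\sum_(q <- s) q ^+ 2)%R <= D.*2.+1)%N ->
  forall q, q \in s -> (mpoly.mmeasure mpoly.mdeg q <= D.+1)%N.
Proof.
move=> sD q qs; rewrite leqNgt; apply/negP => qD.
have [p ps pmax] : exists2 p, p \in s & forall p', p' \in s ->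
    (mpoly.mlead p' <= mpoly.mlead p)%O.
  elim: s q qs {sD qD} => // q0 s IH q _.
  case: s IH => [|q1 s] IH.
    by exists q0; rewrite ?mem_head // => p'; rewrite inE => /eqP ->.
  have [p ps h] := IH q1 (mem_head _ _).
  have [l|l] := leP (mpoly.mlead p) (mpoly.mlead q0).
    exists q0; rewrite ?mem_head // => p'; rewrite inE => /orP [/eqP -> //|/h].
    by move=> /le_trans; apply.
  exists p => [|p']; first by rewrite inE ps orbT.
  rewrite inE => /orP [/eqP ->|/h //].
  exact: ltW.
set m := mpoly.mlead p in pmax.
have q0 : q != 0 by rewrite -(mpoly.mmeasure_poly_eq0 mpoly.mdeg); case: (mpoly.mmeasure _ _) qD.
have mD : (D < mpoly.mdeg m)%N.
  apply: leq_trans (mpoly.lemc_mdeg (pmax _ qs)).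
  by move: qD; rewrite -(mpoly.mlead_deg q0) ltnS.
have p0 : p != 0.
  by apply: contraTneq mD => p0; rewrite /m p0 mpoly.mlead0 mpoly.mdeg0.
have : mpoly.mcoeff (mpoly.mnm_add m m) (\sum_(q <- s) q ^+ 2) = 0.
  apply: mpoly.memN_msupp_eq0; apply: mpoly.msize_mdeg_ge.
  by apply: leq_trans sD _; rewrite mpoly.mdegD -addnn -addSn leq_add // ltnW.
rewrite raddf_sum /= big_seq.
rewrite (eq_bigr (fun q => mpoly.mcoeff m q ^+ 2)); last first.
  by move=> p' ps'; rewrite expr2 mpoly.mleadcMW ?pmax.
rewrite -big_seq => /eqP; rewrite psumr_eq0; last by move=> ? _; exact: sqr_ge0.
move=> /allP /(_ p ps); rewrite /= sqrf_eq0 mpoly.mleadc_eq0.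
by rewrite (negbTE p0).
Qed.

End Interpolation.

Lemma cauchy_schwarz (R : realDomainType) (I : finType) (a b : I -> R) :
  (\sum_i a i * b i) ^+ 2 <= (\sum_i a i ^+ 2) * (\sum_i b i ^+ 2).
Proof.
have : 0 <= \sum_i \sum_j (a i * b j - a j * b i) ^+ 2.
  by apply: sumr_ge0 => i _; apply: sumr_ge0 => j _; exact: sqr_ge0.
have -> : \sum_i \sum_j (a i * b j - a j * b i) ^+ 2 =
   2 * ((\sum_i a i ^+ 2) * (\sum_i b i ^+ 2)) - 2 * (\sum_i a i * b i) ^+ 2.
  transitivity (\sum_i \sum_j (a i ^+ 2 * b j ^+ 2) +
    \sum_i \sum_j (a j ^+ 2 * b i ^+ 2) - 2 * \sum_i \sum_j (a i * b i) * (a j * b j)).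
    rewrite mulr_sumr -big_split -sumrB; apply: eq_bigr => i _ /=.
    rewrite mulr_sumr -big_split -sumrB; apply: eq_bigr => j _ /=; ring.
  rewrite [X in _ + X - _]exchange_big /= -mulr2n -[X in X - _]mulr_natl; congr (2 * _ - 2 * _).
    by rewrite mulr_suml; apply: eq_bigr => i _; rewrite mulr_sumr.
  by rewrite expr2 mulr_suml; apply: eq_bigr => i _; rewrite mulr_sumr.
by rewrite -mulrBr pmulr_rge0 ?ltr0n // subr_ge0.
Qed.

Section GramMatrices.
Context {R : realType} {N : nat} (D : nat).
Implicit Types (p q h : mpolynomial R N).

Let K := #|{: mpoly.bmultinom N D.+1}|.

Definition gram_mon (i : 'I_K) : mpoly.multinom N := mpoly.bmnm (enum_val i).

Definition gram_var (i : 'I_K) : mpolynomial R N := mpoly.mpolyX R (gram_mon i).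

Lemma gram_decomp q : (mpoly.mmeasure mpoly.mdeg q <= D.+1)%N ->
  q = \sum_i mpoly.mcoeff (gram_mon i) q *: gram_var i.
Proof.
move=> qD; rewrite {1}(mpoly.mpolywE qD) (reindex (@enum_val _ xpredT)) //=.
by apply: onW_bij; exact: enum_val_bij.
Qed.

Definition gram (s : seq (mpolynomial R N)) (i j : 'I_K) : R :=
  \sum_(q <- s) mpoly.mcoeff (gram_mon i) q * mpoly.mcoeff (gram_mon j) q.

Lemma qform_gram (A : comAlgType R) s (x : 'I_K -> A) : qform (gram s) x =
  \sum_(q <- s) (\sum_i mpoly.mcoeff (gram_mon i) q *: x i) ^+ 2.
Proof.
rewrite /qform; under eq_bigr => i _.
  under eq_bigr => j _ do rewrite /gram scaler_suml.
  over.
under eq_bigr => i _ do rewrite exchange_big /=.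
rewrite exchange_big; apply: eq_bigr => q _ /=.
rewrite expr2 mulr_suml; apply: eq_bigr => i _.
rewrite mulr_sumr; apply: eq_bigr => j _.
by rewrite -scalerAl -scalerAr scalerA.
Qed.

(** By interpolation each coefficient is a fixed combination of grid values; Cauchy-Schwarz bounds
    its square by the squared values of [q], which add up over [s] to the values of the sum of
    squares. *)
Lemma gram_bound : exists (B : 'I_K -> R) (G : seq ('rV[R]_N)), (forall i, 0 <= B i) /\
  forall s, (mpoly.mmeasure mpoly.mdeg (\sum_(q <- s) q ^+ 2)%R <= D.*2.+1)%N ->
    forall i, gram s i i <= B i * \sum_(x <- G) mpoly.meval (x 0) (\sum_(q <- s) q ^+ 2).
Proof.
have /choice [w wE] : forall i, exists w : {ffun 'I_N -> 'I_D.+1} -> R,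
    forall p, (mpoly.mmeasure mpoly.mdeg p <= D.+1)%N ->
    mpoly.mcoeff (gram_mon i) p = \sum_j w j * mpoly.meval (fun i => (j i)%:R) p.
  by move=> i; apply: mcoeff_interpolation; exact: mpoly.bmdeg.
pose g (j : {ffun 'I_N -> 'I_D.+1}) : 'rV[R]_N := \row_i (j i)%:R.
exists (fun i => \sum_j w i j ^+ 2), [seq g j | j <- index_enum _]; split.
  by move=> i; apply: sumr_ge0 => j _; exact: sqr_ge0.
move=> s sD i; rewrite big_map.
under [X in _ <= _ * X]eq_bigr do rewrite raddf_sum /=.
rewrite exchange_big mulr_sumr /gram big_seq [leRHS]big_seq.
apply: ler_sum => q qs; rewrite -expr2 wE ?(msize_sum_sqr sD) //.
apply: le_trans (cauchy_schwarz _ _) _; rewrite ler_wpM2l //.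
  by apply: sumr_ge0 => j _; exact: sqr_ge0.
rewrite le_eqVlt; apply/orP; left; apply/eqP; apply: eq_bigr => j _.
rewrite rmorphXn; congr (_ ^+ 2); apply: mpoly.meval_eq => k.
by rewrite mxE.
Qed.

End GramMatrices.

Section SosPencil.
Context {R : realType} {N : nat}.

(* The Gram matrices of a sum of squares of bounded degree are bounded by its
   values at finitely many points, so the admissible pairs made of a parameter
   [t <= T] and a Gram matrix form a compact set, on which [t] has a minimum. *)
Lemma sos_pencil_min (h0 h1 : mpolynomial R N) :
  (exists2 t : R, 0 <= t & sos (h0 + t *: h1)) ->
  exists t0 : R, [/\ 0 <= t0, sos (h0 + t0 *: h1) &
    forall t, 0 <= t -> sos (h0 + t *: h1) -> t0 <= t].
Proof.
move=> [T T0 sT].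
pose D := maxn (mpoly.mmeasure mpoly.mdeg h0) (mpoly.mmeasure mpoly.mdeg h1).
have hD t : (mpoly.mmeasure mpoly.mdeg (h0 + t *: h1)%R <= D.*2.+1)%N.
  apply: leq_trans (mpoly.msizeD_le _ _) _; rewrite geq_max.
  have DD : (D <= D.*2.+1)%N by rewrite -addnn leqW // leq_addr.
  rewrite (leq_trans (leq_maxl _ _) DD) /=.
  apply: leq_trans (mpoly.msizeZ_le _ _) _.
  exact: leq_trans (leq_maxr _ _) DD.
set K := #|{: mpoly.bmultinom N D.+1}|.
have [B [G [B0 BG]]] := @gram_bound R N D.
(* Bounds the diagonal Gram entries for all parameters in [[0, T]] at once; the off-diagonal ones
   follow by the arithmetic-geometric mean inequality. *)
pose b := (\sum_i B i) * \sum_(x <- G) (`|mpoly.meval (x 0) h0| + T * `|mpoly.meval (x 0) h1|).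
have Bi i : B i <= \sum_i B i by rewrite (bigD1 i) //= lerDl sumr_ge0.
have gramii (s : seq (mpolynomial R N)) t : 0 <= t -> t <= T ->
    h0 + t *: h1 = \sum_(q <- s) q ^+ 2 -> forall i : 'I_K, gram s i i <= b.
  move=> t0 tT hs i; have := hD t; rewrite hs => /BG => /(_ i) h.
  apply: le_trans h _; rewrite -hs; apply: ler_pM => //.
    apply: sumr_ge0 => x _; rewrite hs raddf_sum /=; apply: sumr_ge0 => q _.
    by rewrite rmorphXn sqr_ge0.
  apply: ler_sum => x _; rewrite mpoly.mevalD mpoly.mevalZ; apply: lerD; first exact: ler_norm.
  apply: le_trans (ler_norm _) _; rewrite normrM (ger0_norm t0).
  by rewrite ler_wpM2r.
have b0 : 0 <= b.
  apply: mulr_ge0; first exact: sumr_ge0.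
  by apply: sumr_ge0 => x _; rewrite addr_ge0 ?mulr_ge0.
have gramij s t : 0 <= t -> t <= T ->
    h0 + t *: h1 = \sum_(q <- s) q ^+ 2 -> forall i j : 'I_K, `|gram s i j| <= b.
  move=> t0 tT hs i j.
  have hi := gramii _ _ t0 tT hs i; have hj := gramii _ _ t0 tT hs j.
  have : 2 * `|gram s i j| <= gram s i i + gram s j j.
    rewrite /gram -big_split /=; apply: le_trans (_ : _ <= 2 * \sum_(q <- s) _) _.
      by rewrite ler_pM2l //; exact: ler_norm_sum.
    rewrite mulr_sumr; apply: ler_sum => q _; rewrite normrM -!expr2.
    rewrite -[X in _ <= X + _]real_normK ?num_real // -[X in _ <= _ + X]real_normK ?num_real //.
    have := sqr_ge0 (`|mpoly.mcoeff (gram_mon i) q| - `|mpoly.mcoeff (gram_mon j) q|).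
    rewrite sqrrB; lra.
  by move=> h; lra.
pose tv (v : 'rV[R]_(1 + K * K)) := v 0 (lshift _ 0).
pose Qv (v : 'rV[R]_(1 + K * K)) (i j : 'I_K) := v 0 (rshift 1 (mxvec_index i j)).
have ctv : continuous tv by exact: coord_continuous.
have cQv i j : continuous (fun v => Qv v i j) by exact: coord_continuous.
have cq (x : 'I_K -> R^o) : continuous (fun v => qform (Qv v) x : R).
  change (continuous (fun v => \sum_i \sum_j Qv v i j * (x i * x j : R))).
  apply: continuous_sumr => i; apply: continuous_sumr => j.
  by apply: continuous_mulr => //; exact: continuous_cst.
have cst (c : R) : continuous (fun _ : 'rV[R]_(1 + K * K) => c) by exact: continuous_cst.
(* A vector stores the parameter followed by the matrix entries. The polynomial identity is imposed
   at every point, each time a closed condition, and recovered at the end by [meval_inj]. *)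
pose S : set 'rV[R]_(1 + K * K) :=
  [set v | 0 <= tv v] `&` [set v | tv v <= T] `&`
  [set v | forall x : 'I_K -> R^o, 0 <= qform (Qv v) x :> R] `&`
  [set v | forall z : 'rV[R]_N, mpoly.meval (z 0) h0 + tv v * mpoly.meval (z 0) h1 =
     qform (Qv v) (fun i => mpoly.meval (z 0) (gram_var i) : R^o)] `&`
  [set v | forall i, `|v 0 i| <= Num.max T b].
have Sne t s : 0 <= t -> t <= T -> h0 + t *: h1 = \sum_(q <- s) q ^+ 2 ->
    exists2 v, S v & tv v = t.
  move=> t0 tT hs.
  pose v : 'rV[R]_(1 + K * K) := row_mx (t%:M) (mxvec (\matrix_(i, j) gram s i j)).
  have tvE : tv v = t by rewrite /tv /v row_mxEl mxE eqxx.
  have QvE i j : Qv v i j = gram s i j by rewrite /Qv /v row_mxEr mxvecE mxE.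
  have qvE (x : 'I_K -> R^o) : qform (Qv v) x = qform (gram s) x.
    by apply: eq_bigr => i _; apply: eq_bigr => j _; rewrite QvE.
  exists v => //; split; first split; first split; first split.
  - by rewrite /= tvE.
  - by rewrite /= tvE.
  - move=> x; rewrite qvE qform_gram; apply: sumr_ge0 => q _; exact: sqr_ge0.
  - move=> z; rewrite qvE qform_gram tvE -mpoly.mevalZ -mpoly.mevalD hs raddf_sum /=.
    rewrite big_seq [RHS]big_seq; apply: eq_bigr => q qs.
    rewrite rmorphXn; congr (_ ^+ 2).
    have qD : (mpoly.mmeasure mpoly.mdeg q <= D.+1)%N.
      by apply: msize_sum_sqr qs; rewrite -hs.
    rewrite {1}(gram_decomp qD) raddf_sum /=.
    by apply: eq_bigr => i _; rewrite mpoly.mevalZ.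
  - move=> i; rewrite le_max; case: (split_ordP i) => k ->.
      by rewrite (ord1 k) [v _ _]tvE ger0_norm // tT.
    by case/mxvec_indexP: k => a c; rewrite [v _ _]QvE (gramij s t) ?orbT.
have cS : closed S.
  apply: closedI; first apply: closedI; first apply: closedI; first apply: closedI.
  - exact: closed_level_le.
  - exact: closed_level_le.
  - by apply: closed_forall => x; exact: closed_level_le.
  - apply: closed_forall => z; apply: closed_level_eq => //.
    apply: continuous_addr; first exact: continuous_cst.
    by apply: continuous_mulr => //; exact: continuous_cst.
  - apply: closed_forall => i; apply: closed_level_le => //.
    by apply: continuous_normr; exact: coord_continuous.
have [s0 hs0] := sT.
have [v0 Sv0 _] := Sne _ _ T0 (lexx _) hs0.
have [v Sv vmin] := rV_argmin (ex_intro _ v0 Sv0) cS (fun v (h : S v) => h.2) ctv.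
exists (tv v); have [[[[t0 tT] Qpos] Qev] _] := Sv.
split => // [|t t0' [s hs]]; last first.
  have [tT'|/ltW Tt] := leP t T; last exact: le_trans tT Tt.
  by have [v' Sv' <-] := Sne _ _ t0' tT' hs; exact: vmin.
suff -> : h0 + tv v *: h1 = qform (Qv v) (@gram_var R N D) by exact: sos_qform.
apply: meval_inj => z; rewrite mpoly.mevalD mpoly.mevalZ Qev /qform raddf_sum /=.
apply: eq_bigr => i _; rewrite raddf_sum; apply: eq_bigr => j _ /=.
by rewrite mpoly.mevalZ mpoly.mevalM.
Qed.

End SosPencil.

(** * Iterated directional derivatives *)

Section DirectionalDerivatives.
Context {R : realType} {n : nat}.
Implicit Types (f g : 'rV[R]_n -> R) (x u v h : 'rV[R]_n).

(** In coordinates rather than as ['D_v f]: linearity in [v] and regularity then come directly from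
    [Ck], which speaks of partial derivatives. *)
Definition Dv v f : 'rV[R]_n -> R := fun x => \sum_i v 0 i * partial i f x.

Lemma DvE v f x : differentiable f x -> Dv v f x = 'D_v f x.
Proof.
move=> df; rewrite deriveE // {2}(row_sum_delta v) raddf_sum /=.
by apply: eq_bigr => i _; rewrite linearZ /= -deriveE.
Qed.

Lemma is_derive_line f x v (s : R) : differentiable f (x + s *: v) ->
  is_derive s (1 : R) (fun s => f (x + s *: v)) (Dv v f (x + s *: v)).
Proof.
move=> df; rewrite DvE //.
have e : (fun h : R => h^-1 *: (((fun s => f (x + s *: v)) \o shift s) (h *: (1 : R))
       - f (x + s *: v))) =
    (fun h : R => h^-1 *: ((f \o shift (x + s *: v)) (h *: v) - f (x + s *: v))).
  apply/funext => h /=; congr (_ *: (f _ - _)).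
  by rewrite [h *: 1]mulr1 scalerDl addrCA.
split; first by rewrite /derivable e; exact: diff_derivable.
by rewrite /derive e.
Qed.

Lemma partial_addM i f g (c : R) :
  (forall x, differentiable f x) -> (forall x, differentiable g x) ->
  partial i (fun x => f x + c * g x) = fun x => partial i f x + c * partial i g x.
Proof.
move=> df dg; apply/funext => x.
have dfx : derivable f x (delta_mx 0 i) by exact: diff_derivable.
have dgx : derivable g x (delta_mx 0 i) by exact: diff_derivable.
by rewrite /partial (deriveD dfx (derivableZ dgx)) (deriveZ c dgx).
Qed.

Lemma Ck_ext k f g : f =1 g -> Ck k f -> Ck k g.
Proof. by move/funext ->. Qed.

Lemma Ck_diff k f : Ck k.+1 f -> forall x, differentiable f x.
Proof. by case. Qed.

Lemma Ck_continuous k f : Ck k f -> continuous f.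
Proof.
case: k => [h //|k /Ck_diff df x]; exact: differentiable_continuous.
Qed.

Lemma Ck_partial k i f : Ck k.+1 f -> Ck k (partial i f).
Proof. by move=> [_ h]; exact: h. Qed.

Lemma Ck_addM k f g (c : R) : Ck k f -> Ck k g -> Ck k (fun x => f x + c * g x).
Proof.
elim: k f g => [|k IH] f g /=.
  move=> cf cg; apply: continuous_addr => //.
  by apply: continuous_mulr => //; exact: continuous_cst.
move=> [df pf] [dg pg]; split => [x|i].
  exact: differentiableD (differentiableZ c (dg x)).
by rewrite partial_addM //; exact: IH.
Qed.

Lemma Ck0 k : Ck k (fun _ : 'rV[R]_n => 0 : R).
Proof.
elim: k => [|k IH] /=; first exact: continuous_cst.
split => [x|i]; first exact: differentiable_cst.
by rewrite (_ : partial i _ = fun=> 0) //; apply/funext => x; exact: derive_cst.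
Qed.

Lemma CkS k f : Ck k.+1 f -> Ck k f.
Proof.
elim: k f => [|k IH] f; first exact: Ck_continuous.
by move=> [df pf]; split => // i; apply: IH; exact: pf.
Qed.

Lemma Ck_le k l f : (k <= l)%N -> Ck l f -> Ck k f.
Proof.
by move=> /subnK <-; elim: (l - k)%N => // j IH; rewrite addSn => /CkS.
Qed.

Lemma Ck_Dv k v f : Ck k.+1 f -> Ck k (Dv v f).
Proof.
move=> [_ pf]; rewrite /Dv; elim: (index_enum _) => [|i r IH].
  by apply: Ck_ext (Ck0 k) => x; rewrite big_nil.
apply: Ck_ext (Ck_addM (v 0 i) IH (pf i)) => x.
by rewrite big_cons addrC.
Qed.

Lemma Dv_addM v f g (c : R) :
  (forall x, differentiable f x) -> (forall x, differentiable g x) ->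
  Dv v (fun x => f x + c * g x) = fun x => Dv v f x + c * Dv v g x.
Proof.
move=> df dg; apply/funext => x; rewrite /Dv mulr_sumr -big_split.
by apply: eq_bigr => i _; rewrite partial_addM //=; ring.
Qed.

Lemma Dv_line u v (s : R) f : Dv (u + s *: v) f = fun x => Dv u f x + s * Dv v f x.
Proof.
apply/funext => x; rewrite /Dv mulr_sumr -big_split.
by apply: eq_bigr => i _; rewrite !mxE /=; ring.
Qed.

Lemma continuous_within (f : R -> R) (a b : R) (df : R -> R) :
  (forall s, is_derive s (1 : R) f (df s)) -> {within `[a, b], continuous f}.
Proof. by move=> h; apply: derivable_within_continuous => s _; case: (h s). Qed.

Lemma line_MVT f x v (t : R) : 0 < t -> (forall x, differentiable f x) ->
  exists2 s, 0 < s < t & f (x + t *: v) - f x = t * Dv v f (x + s *: v).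
Proof.
move=> t0 df; have d s := is_derive_line (df (x + s *: v)).
have [s] := MVT t0 (fun s _ => d s) (continuous_within d).
rewrite in_itv /= => st e; exists s => //.
by move: e; rewrite scale0r addr0 subr0 mulrC.
Qed.

(** The mean value theorem twice: along [u] for the increment of [f] by [t *: v], then along [v] for
    [Dv u f]. *)
Lemma second_difference f x u v (t : R) : 0 < t -> Ck 2 f ->
  exists s1 s2, [/\ 0 < s1 < t, 0 < s2 < t &
    f (x + t *: u + t *: v) - f (x + t *: u) - f (x + t *: v) + f x =
    t * t * Dv v (Dv u f) (x + s1 *: u + s2 *: v)].
Proof.
move=> t0 f2; have df := Ck_diff f2; have dDf := Ck_diff (Ck_Dv u f2).
pose g y := f (y + t *: v) + (- 1) * f y.
have dft y : differentiable (fun y => f (y + t *: v)) y.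
  apply: (@differentiable_comp _ _ _ _ (id + cst (t *: v)) f); last exact: df.
  by apply: differentiableD.
have dg y : differentiable g y by exact: differentiableD (differentiableZ _ (df y)).
have [s1 s1t e1] := line_MVT x u t0 dg.
have [s2 s2t e2] := line_MVT (x + s1 *: u) v t0 dDf.
exists s1, s2; split => //.
rewrite -mulrA -e2; transitivity (g (x + t *: u) - g x).
  by rewrite /g; ring.
rewrite e1; congr (_ * _); rewrite Dv_addM // mulN1r; congr (_ - _).
rewrite /Dv; apply: eq_bigr => i _; congr (_ * _).
rewrite /partial /derive.
apply: (congr1 (fun F : R -> R => lim (F @ 0^'))); apply/funext => h /=.
by rewrite !addrA.
Qed.

Lemma continuous_limit_eq (F : 'rV[R]_n -> R) x u v (e : R) : 0 < e ->
  continuous F -> exists2 t, 0 < t & forall s1 s2, 0 < s1 < t -> 0 < s2 < t ->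
    `|F (x + s1 *: u + s2 *: v) - F x| < e.
Proof.
move=> e0 cF.
have /cvgrPdist_lt /(_ e e0) /nbhs_ballP [d d0 hd] := cF x.
pose w := `|u| + `|v| + 1.
have w0 : 0 < w by rewrite /w; have := normr_ge0 u; have := normr_ge0 v; lra.
exists (d / w) => [|s1 s2 /andP [s10 s1t] /andP [s20 s2t]]; first by rewrite divr_gt0.
rewrite distrC; apply: hd; rewrite -ball_normE /ball_ /=.
rewrite opprD opprD !addrA subrr sub0r -opprD normrN.
apply: le_lt_trans (ler_normD _ _) _; rewrite !normrZ !gtr0_norm //.
have h1 : s1 * `|u| <= d / w * `|u| by rewrite ler_wpM2r // ltW.
have h2 : s2 * `|v| <= d / w * `|v| by rewrite ler_wpM2r // ltW.
have dw : d / w * w = d by rewrite divfK ?gt_eqF.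
have dw0 : 0 < d / w by rewrite divr_gt0.
apply: le_lt_trans (lerD h1 h2) _; rewrite -mulrDr -[ltRHS]dw ltr_pM2l // /w.
by rewrite ltrDl.
Qed.

(* Both mixed derivatives are limits of the same second difference. *)
Lemma DvC u v f : Ck 2 f -> Dv v (Dv u f) = Dv u (Dv v f).
Proof.
move=> f2; apply/funext => x; apply/eqP; rewrite -subr_eq0 -normr_eq0.
rewrite eq_le normr_ge0 andbT; apply/ler_addgt0Pl => e e0; rewrite addr0.
have c1 : continuous (Dv v (Dv u f)) by exact: Ck_continuous (Ck_Dv v (Ck_Dv u f2)).
have c2 : continuous (Dv u (Dv v f)) by exact: Ck_continuous (Ck_Dv u (Ck_Dv v f2)).
have e20 : 0 < e / 2 by rewrite divr_gt0.
have [t1 t10 h1] := continuous_limit_eq x u v e20 c1.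
have [t2 t20 h2] := continuous_limit_eq x v u e20 c2.
pose t := Num.min t1 t2.
have t0 : 0 < t by rewrite lt_min t10 t20.
have [s1 [s2 [s1t s2t E1]]] := second_difference x u v t0 f2.
have [r1 [r2 [r1t r2t E2]]] := second_difference x v u t0 f2.
have tt1 : t <= t1 by rewrite ge_min lexx.
have tt2 : t <= t2 by rewrite ge_min lexx orbT.
have lt_t (s a b : R) : a <= b -> 0 < s < a -> 0 < s < b.
  by move=> tt /andP [-> st]; exact: lt_le_trans st tt.
have {}h1 := h1 _ _ (lt_t _ _ _ tt1 s1t) (lt_t _ _ _ tt1 s2t).
have {}h2 := h2 _ _ (lt_t _ _ _ tt2 r1t) (lt_t _ _ _ tt2 r2t).
have EE : f (x + t *: u + t *: v) - f (x + t *: u) - f (x + t *: v) + f x =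
    f (x + t *: v + t *: u) - f (x + t *: v) - f (x + t *: u) + f x.
  by rewrite (addrAC x (t *: u)); congr (_ + _); exact: addrAC.
have E : Dv v (Dv u f) (x + s1 *: u + s2 *: v) = Dv u (Dv v f) (x + r1 *: v + r2 *: u).
  apply: (@mulfI _ (t * t)); first by rewrite mulf_neq0 ?gt_eqF.
  exact: etrans (esym E1) (etrans EE E2).
rewrite E in h1; move: h1 h2.
move: (Dv v (Dv u f) x) (Dv u (Dv v f) x) (Dv u (Dv v f) _) => a b c h1 h2.
rewrite (_ : a - b = (c - b) - (c - a)); last by ring.
apply: le_trans (ler_normB _ _) _; rewrite [leRHS](splitr e).
exact: ltW (ltrD h2 h1).
Qed.

Definition iterDv (us : seq 'rV[R]_n) f := foldr Dv f us.

Lemma Ck_iterD k us f : Ck (size us + k) f -> Ck k (iterDv us f).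
Proof.
elim: us k => [//|u us IH] k; rewrite [size _]/= addSnnS => h.
by apply: Ck_Dv; exact: IH.
Qed.

Lemma iterD_addM us f g (c : R) : Ck (size us) f -> Ck (size us) g ->
  iterDv us (fun x => f x + c * g x) = fun x => iterDv us f x + c * iterDv us g x.
Proof.
elim: us f g => [//|u us IH] f g /= hf hg.
rewrite (IH _ _ (CkS hf) (CkS hg)) Dv_addM //; apply: (@Ck_diff 0); apply: Ck_iterD;
  by rewrite addn1.
Qed.

Lemma Ck_foldr_partial k l f (s : seq 'I_n) : (size s + k <= l)%N -> Ck l f ->
  Ck k (foldr partial f s).
Proof.
elim: s k => [|i s IH] k /=; first exact: Ck_le.
by rewrite addSnnS => h fl; apply: Ck_partial; exact: IH.
Qed.

Lemma partial_sum (I : Type) (r : seq I) (c : I -> R) (F : I -> 'rV[R]_n -> R) i x :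
  (forall j x, differentiable (F j) x) ->
  partial i (fun x => \sum_(j <- r) c j * F j x) x = \sum_(j <- r) c j * partial i (F j) x.
Proof.
move=> dF; elim: r x => [|j r IH] x.
  rewrite big_nil (_ : (fun _ => _) = fun=> 0); first exact: derive_cst.
  by apply/funext => y; rewrite big_nil.
rewrite (_ : (fun _ => _) = fun x => \sum_(j <- r) c j * F j x + c j * F j x); last first.
  by apply/funext => y; rewrite big_cons addrC.
rewrite partial_addM // => [|{IH} {}x].
  by rewrite IH big_cons addrC.
elim: r => [|k r IH].
  rewrite (_ : (fun _ => _) = fun=> 0); first exact: differentiable_cst.
  by apply/funext => y; rewrite big_nil.
rewrite (_ : (fun _ => _) = fun x => \sum_(j <- r) c j * F j x + c k * F k x).
  exact: differentiableD (differentiableZ _ (dF k x)).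
by apply/funext => y; rewrite big_cons addrC.
Qed.

Lemma tensor_app_nabla k f x (u : 'I_k -> 'rV[R]_n) : Ck k f ->
  tensor_app (nabla k f x) u = iterDv [seq u i | i <- enum 'I_k] f x.
Proof.
elim: k x u => [|k IH] x u hf.
  by rewrite /tensor_app big_tuple0 big_ord0 mulr1 ffunE enum_ord0.
rewrite /tensor_app big_tuple_recl enum_ordSl /= -map_comp /Dv.
apply: eq_bigr => i _; pose u' j := u (lift ord0 j).
have IH' y := IH y u' (CkS hf).
rewrite (_ : iterDv _ f = fun y => tensor_app (nabla k f y) u'); last first.
  by apply/funext => y; rewrite IH'.
rewrite /tensor_app.
rewrite (_ : (fun y => _) = fun y => \sum_(s : k.-tuple 'I_n)
   (\prod_(j < k) u' j 0 (tnth s j)) * foldr partial f s y); last first.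
  by apply/funext => y; apply: eq_bigr => s _; rewrite ffunE mulrC.
rewrite partial_sum => [|s y]; last first.
  by apply: (@Ck_diff 0); apply: (@Ck_foldr_partial _ k.+1); rewrite ?size_tuple ?addn1.
rewrite mulr_sumr; apply: eq_bigr => s _.
rewrite ffunE big_ord_recl /= mulrCA [X in _ = _ * X]mulrC; congr (_ * (_ * _)).
by apply: eq_bigr => j _; rewrite /u' !(tnth_nth i).
Qed.

Lemma iterD_nseqSr k h f : iterDv (nseq k.+1 h) f = iterDv (nseq k h) (Dv h f).
Proof. by elim: k f => [//|k IH] f; rewrite -[LHS]/(Dv h (iterDv (nseq k.+1 h) f)) IH. Qed.

Section LinePolynomial.
Variables h v : 'rV[R]_n.

(** The expansion of the k-th power of [Dv h + 'X * Dv v] applied to [f], one factor at a time. By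
    symmetry of mixed derivatives its low coefficients are the binomial ones. *)
Fixpoint line_iterD k f x : {poly R} :=
  if k is k'.+1 then line_iterD k' (Dv h f) x + 'X * line_iterD k' (Dv v f) x
  else (f x)%:P.

Lemma size_line_iterD k f x : (size (line_iterD k f x) <= k.+1)%N.
Proof.
elim: k f => [|k IH] f /=; first exact: size_polyC_leq1.
apply: leq_trans (size_polyD _ _) _; rewrite geq_max (leqW (IH _)) /=.
apply: leq_trans (size_polyMleq _ _) _; rewrite size_polyX add2n /=.
by rewrite ltnS IH.
Qed.

Lemma horner_line_iterD k f x (s : R) : Ck k f ->
  (line_iterD k f x).[s] = iterDv (nseq k (h + s *: v)) f x.
Proof.
elim: k f => [|k IH] f hf; first by rewrite hornerC.
have hh := Ck_Dv h hf; have hv := Ck_Dv v hf.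
rewrite iterD_nseqSr /= !hornerE !IH // Dv_line.
by rewrite iterD_addM ?size_nseq.
Qed.

Lemma line_iterD_coef0 k f x : (line_iterD k f x)`_0 = iterDv (nseq k h) f x.
Proof.
elim: k f => [|k IH] f; first by rewrite coefC.
by rewrite iterD_nseqSr /= coefD coefXM addr0 IH.
Qed.

Lemma coefXMS (p : {poly R}) i : ('X * p)`_i.+1 = p`_i.
Proof. by rewrite coefXM. Qed.

Lemma line_iterD_coef1 k f x : Ck k.+1 f ->
  (line_iterD k.+1 f x)`_1 = k.+1%:R * iterDv (nseq k h) (Dv v f) x.
Proof.
elim: k f => [|k IH] f hf.
  by rewrite /= coefD coefXM /= !coefC /= add0r mul1r.
rewrite -[line_iterD _ _ _]/(line_iterD k.+1 (Dv h f) x + 'X * line_iterD k.+1 (Dv v f) x).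
rewrite coefD coefXMS line_iterD_coef0 (IH _ (Ck_Dv h hf)).
rewrite DvC; last by apply: Ck_le hf.
by rewrite -iterD_nseqSr -[k.+2%:R]natr1 mulrDl mul1r.
Qed.

Lemma line_iterD_coef2 k f x : Ck k.+2 f ->
  (line_iterD k.+2 f x)`_2 *+ 2 = (k.+2 * k.+1)%:R * iterDv (nseq k h) (Dv v (Dv v f)) x.
Proof.
elim: k f => [|k IH] f hf.
  by rewrite /= !(coefD, coefXM, coefC) /= !add0r mulr_natl.
rewrite -[line_iterD _ _ _]/(line_iterD k.+2 (Dv h f) x + 'X * line_iterD k.+2 (Dv v f) x).
rewrite coefD coefXMS mulrnDl (IH _ (Ck_Dv h hf)) (line_iterD_coef1 _ (Ck_Dv v hf)).
rewrite (DvC h v); last by apply: Ck_le hf.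
rewrite (DvC h v); last by apply: Ck_le (Ck_Dv v hf).
rewrite -iterD_nseqSr; set I := iterDv _ _ _.
rewrite -mulr_natr !natrM -[k.+3%:R]natr1 -[k.+2%:R]natr1; ring.
Qed.

End LinePolynomial.

Lemma is_derive_horner (p : {poly R}) (t : R) : is_derive t (1 : R) (horner p) p^`().[t].
Proof.
by split; [exact: derivable_horner|rewrite derivE derive1E].
Qed.

Lemma le_of_derive_le (f g df dg : R -> R) (t : R) : 0 < t -> f 0 <= g 0 ->
  (forall s, is_derive s (1 : R) f (df s)) -> (forall s, is_derive s (1 : R) g (dg s)) ->
  (forall s, 0 < s < t -> df s <= dg s) -> f t <= g t.
Proof.
move=> t0 fg0 hf hg hfg.
have hd s : is_derive s (1 : R) (g - f) (dg s - df s) by exact: is_deriveB.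
have [s] := MVT t0 (fun s _ => hd s) (continuous_within hd).
rewrite in_itv /= subr0 => st e.
have h : 0 <= (g t - f t) - (g 0 - f 0).
  by rewrite [X in 0 <= X]e mulr_ge0 ?subr_ge0 ?hfg // ltW.
by lra.
Qed.

Definition taylor_line N f x h : {poly R} :=
  \poly_(k < N.+1) (iterDv (nseq k h) f x / k`!%:R).

Lemma taylor_line_deriv N f x h :
  (taylor_line N.+1 f x h)^`() = taylor_line N (Dv h f) x h.
Proof.
apply/polyP => i; rewrite coef_deriv !coef_poly ltnS.
case: ltnP => _; last by rewrite mul0rn.
rewrite iterD_nseqSr factS natrM -mulr_natr; field.
by rewrite nat1r !pnatr_eq0 -lt0n fact_gt0.
Qed.

(** The derivative of the remainder of order N + 1 of [f] along [h] is the remainder of order N of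
    [Dv h f]. The induction thus compares derivatives on [[0, t]], and the Lipschitz bound on the
    last available derivative is its base case. *)
Lemma taylor_remainder N f x h (K : R) : Ck N f ->
  (forall t : R, 0 <= t <= 1 ->
     `|iterDv (nseq N h) f (x + t *: h) - iterDv (nseq N h) f x| <= K * t) ->
  forall t : R, 0 <= t <= 1 ->
    `|f (x + t *: h) - (taylor_line N f x h).[t]| <= K * t ^+ N.+1 / N.+1`!%:R.
Proof.
elim: N f => [|N IH] f hf hK t t01.
  rewrite /taylor_line poly_def big_ord1 divr1 expr0 alg_polyC hornerC.
  by rewrite divr1 expr1; exact: hK.
have hK1 (s : R) : 0 <= s <= 1 -> `|iterDv (nseq N h) (Dv h f) (x + s *: h) -
    iterDv (nseq N h) (Dv h f) x| <= K * s by rewrite -iterD_nseqSr; exact: hK.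
have {IH hK1} h1 := IH (Dv h f) (Ck_Dv h hf) hK1.
have E0 : f (x + 0 *: h) - (taylor_line N.+1 f x h).[0] = 0.
  by rewrite horner_coef0 coef_poly scale0r addr0 divr1 subrr.
have [t0|t0] : t = 0 \/ 0 < t.
- by case/andP: t01; rewrite le_eqVlt => /orP [/eqP <-|]; [left|right].
- by rewrite t0 E0 normr0 expr0n mulr0 mul0r.
pose E s := f (x + s *: h) - (taylor_line N.+1 f x h).[s].
pose dE s := Dv h f (x + s *: h) - (taylor_line N (Dv h f) x h).[s].
pose P : {poly R} := (K / N.+2`!%:R) *: 'X^(N.+2).
have hE s : is_derive s (1 : R) E (dE s).
  have h2 := is_derive_line (Ck_diff hf (x + s *: h)).
  have h3 := is_derive_horner (taylor_line N.+1 f x h) s.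
  by rewrite taylor_line_deriv in h3; exact: (is_deriveB h2 h3).
have PE s : P.[s] = K * s ^+ N.+2 / N.+2`!%:R by rewrite hornerZ hornerXn mulrAC.
have dPE s : P^`().[s] = K * s ^+ N.+1 / N.+1`!%:R.
  rewrite derivZ derivXn hornerZ hornerMn hornerXn [N.+2.-1]/= [N.+2`!]factS natrM.
  rewrite -[s ^+ _ *+ _]mulr_natr.
  have h0 : N.+2%:R != 0 :> R by rewrite pnatr_eq0.
  have h1' : N.+1`!%:R != 0 :> R by rewrite pnatr_eq0 -lt0n fact_gt0.
  move: h0 h1'; move: (N.+2%:R) (N.+1`!%:R) (s ^+ N.+1) => a b c a0 b0.
  by field; rewrite a0 b0.
have sub01 s : 0 < s < t -> 0 <= s <= 1.
  by case/andP: t01 => _ t1 /andP [s0 st]; rewrite (ltW s0) (le_trans (ltW st)).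
have hP s := is_derive_horner P s.
rewrite -PE ler_norml; apply/andP; split.
  rewrite lerNl -/(E t); have hNE s : is_derive s (1 : R) (- E) (- dE s) by exact: is_deriveN.
  apply: (le_of_derive_le t0 _ hNE hP) => [|s /sub01 /h1].
    by rewrite [X in X <= _](_ : _ = - E 0) // /E E0 PE expr0n mulr0 mul0r oppr0.
  by rewrite dPE ler_norml lerNl => /andP [].
apply: (le_of_derive_le t0 _ hE hP) => [|s /sub01 /h1].
  by rewrite /E E0 PE expr0n mulr0 mul0r.
by rewrite dPE ler_norml => /andP [].
Qed.

End DirectionalDerivatives.

(** * Tensor norms and Taylor remainders *)

Section Norms.
Context {R : realType}.

Lemma set_max_eq (A : set R) (m : R) : A m -> ubound A m -> set_max A = m.
Proof.
move=> Am um; rewrite /set_max.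
have [Ax ux] := xgetPex 0 (ex_intro (fun m => A m /\ ubound A m) m (conj Am um)).
by apply/eqP; rewrite eq_le um // ux.
Qed.

Lemma set_min_eq (A : set R) (m : R) : A m -> lbound A m -> set_min A = m.
Proof.
move=> Am um; rewrite /set_min.
have [Ax ux] := xgetPex 0 (ex_intro (fun m => A m /\ lbound A m) m (conj Am um)).
by apply/eqP; rewrite eq_le um // ux.
Qed.

Definition dotr n (u v : 'rV[R]_n) : R := \sum_i u 0 i * v 0 i.

Lemma enorm_ge0 n (u : 'rV[R]_n) : 0 <= enorm u.
Proof. exact: sqrtr_ge0. Qed.

Lemma dotr_le n (u v : 'rV[R]_n) : `|dotr u v| <= enorm u * enorm v.
Proof.
rewrite -ler_sqr ?nnegrE ?mulr_ge0 ?enorm_ge0 // exprMn !enorm_sqr real_normK ?num_real //.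
exact: cauchy_schwarz.
Qed.

Lemma enormZ n (c : R) (u : 'rV[R]_n) : enorm (c *: u) = `|c| * enorm u.
Proof.
apply/eqP; rewrite -(eqrXn2 (n := 2)) ?mulr_ge0 ?enorm_ge0 // exprMn !enorm_sqr.
rewrite real_normK ?num_real // mulr_sumr; apply/eqP/eq_bigr => i _.
by rewrite mxE exprMn.
Qed.

Lemma enorm_eq0 n (u : 'rV[R]_n) : enorm u = 0 -> u = 0.
Proof.
move=> u0; have := enorm_sqr u; rewrite u0 expr0n /= => /esym/eqP.
rewrite psumr_eq0 => [/allP h|i _]; last exact: sqr_ge0.
apply/rowP => i; rewrite mxE; apply/eqP; rewrite -sqrf_eq0.
by apply: h; rewrite mem_index_enum.
Qed.

Lemma enorm_line n (h v : 'rV[R]_n) (s : R) :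
  enorm (h + s *: v) ^+ 2 = enorm h ^+ 2 + 2 * s * dotr h v + s ^+ 2 * enorm v ^+ 2.
Proof.
rewrite !enorm_sqr /dotr !mulr_sumr -!big_split; apply: eq_bigr => i _ /=.
by rewrite !mxE; ring.
Qed.

Lemma coord_le_enorm n (u : 'rV[R]_n) i : `|u 0 i| <= enorm u.
Proof.
rewrite -ler_sqr ?nnegrE ?enorm_ge0 // enorm_sqr real_normK ?num_real //.
by rewrite (bigD1 i) //= lerDl sumr_ge0 // => j _; exact: sqr_ge0.
Qed.

Lemma continuous_enorm_sqr n (a : 'rV[R]_n) : continuous (fun x : 'rV[R]_n => enorm (x - a) ^+ 2).
Proof.
rewrite (_ : (fun _ => _) = fun x : 'rV[R]_n => \sum_i (x 0 i - a 0 i) * (x 0 i - a 0 i)).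
  by apply: continuous_sumr => i; apply: continuous_mulr; apply: continuous_addr;
    try exact: coord_continuous; exact: continuous_cst.
by apply/funext => x; rewrite enorm_sqr; apply: eq_bigr => i _; rewrite !mxE.
Qed.

(** The unit vectors [u0] exclude the empty set, where [set_max] falls back on its default. The
    maximum is then taken over a product of spheres, coded as a compact set of row vectors of length
    d * n. *)
Lemma tensor_norm_attained n d (A : @tensor R n d) (u0 : 'I_d -> 'rV[R]_n) :
  (forall k, enorm (u0 k) = 1) ->
  ubound [set `|tensor_app A u| | u in [set u | forall k, enorm (u k) = 1]] (tensor_norm A).
Proof.
move=> hu0.
pose U (w : 'rV[R]_(d * n)) (k : 'I_d) : 'rV[R]_n := row k (vec_mx w).
have UE w k i : U w k 0 i = w 0 (mxvec_index k i) by rewrite !mxE.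
pose V (u : 'I_d -> 'rV[R]_n) : 'rV[R]_(d * n) := mxvec (\matrix_(k, i) u k 0 i).
have UV u : U (V u) = u by apply/funext => k; apply/rowP => i; rewrite UE mxvecE mxE.
have cU k i : continuous (fun w => U w k 0 i).
  rewrite (_ : (fun _ => _) = fun w : 'rV[R]_(d * n) => w 0 (mxvec_index k i)).
    exact: coord_continuous.
  by apply/funext => w; rewrite UE.
pose S := [set w : 'rV[R]_(d * n) | forall k, enorm (U w k) ^+ 2 = 1].
have SP w : S w <-> forall k, enorm (U w k) = 1.
  split => h k; last by rewrite h expr1n.
  by apply/eqP; rewrite -(eqrXn2 (n := 2)) ?enorm_ge0 // h expr1n.
have cS : closed S.
  apply: closed_forall => k; apply: closed_level_eq; last exact: continuous_cst.
  rewrite (_ : (fun _ => _) = fun w => \sum_i U w k 0 i * U w k 0 i).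
    by apply: continuous_sumr => i; exact: continuous_mulr.
  by apply/funext => w; rewrite enorm_sqr.
have bS w : S w -> forall i, `|w 0 i| <= 1.
  by move=> /SP h; case/mxvec_indexP => k i; rewrite -UE -(h k) coord_le_enorm.
have S0 : S !=set0 by exists (V u0); apply/SP => k; rewrite UV.
have cA : continuous (fun w => - 1 * `|tensor_app A (U w)|).
  apply: continuous_mulr; first exact: continuous_cst.
  apply: continuous_normr; apply: continuous_sumr => s.
  apply: continuous_mulr; first exact: continuous_cst.
  by apply: continuous_prodr => k; exact: cU.
have [c Sc cmax] := rV_argmin S0 cS bS cA.
have ub : ubound [set `|tensor_app A u| | u in [set u | forall k, enorm (u k) = 1]]
    `|tensor_app A (U c)|.
  move=> _ [u hu <-]; have : S (V u) by apply/SP => k; rewrite UV hu.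
  by move=> /cmax; rewrite UV !mulN1r lerN2.
rewrite /tensor_norm (set_max_eq _ ub) //.
by exists (U c) => //; exact/SP.
Qed.

(** A zero vector makes both sides vanish; otherwise the normalised vectors are the witness required
    by [tensor_norm_attained]. *)
Lemma tensor_app_le n d (A : @tensor R n d) (u : 'I_d -> 'rV[R]_n) :
  `|tensor_app A u| <= tensor_norm A * \prod_k enorm (u k).
Proof.
have [[k uk]|u0] := pselect (exists k, enorm (u k) = 0).
  rewrite (bigD1 k) //= uk mul0r mulr0 /tensor_app big1 ?normr0 // => s _.
  by rewrite (bigD1 k) //= (enorm_eq0 uk) mxE mul0r mulr0.
have {}u0 k : enorm (u k) != 0 by apply/eqP => h; apply: u0; exists k.
pose w k := (enorm (u k))^-1 *: u k.
have w1 k : enorm (w k) = 1.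
  by rewrite enormZ ger0_norm ?invr_ge0 ?enorm_ge0 // mulVf.
have E : tensor_app A u = tensor_app A w * \prod_k enorm (u k).
  rewrite /tensor_app mulr_suml; apply: eq_bigr => s _; rewrite -mulrA; congr (_ * _).
  rewrite -big_split; apply: eq_bigr => k _ /=.
  by rewrite mxE mulrAC mulVf ?mul1r.
have P0 : 0 <= \prod_k enorm (u k) by apply: prodr_ge0 => k _; exact: enorm_ge0.
rewrite E normrM (ger0_norm P0) ler_wpM2r //.
by apply: (tensor_norm_attained w1); exists w.
Qed.

End Norms.

(** * Taylor estimates for first and second directional derivatives *)

Section TaylorErrors.
Context {R : realType} {n : nat}.
Variables (f : 'rV[R]_n -> R) (d : nat) (L mu : R).
Hypothesis (hf : Ck d f).

Lemma hessian_Dv : (2 <= d)%N ->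
  (forall x : 'rV[R]_n, psdmx (hessian f x - mu%:M)) ->
  forall x v, mu * enorm v ^+ 2 <= Dv v (Dv v f) x.
Proof.
move=> d2 hmu x v; have f2 := Ck_le d2 hf.
have -> : Dv v (Dv v f) x = (v *m hessian f x *m v^T) 0 0; last first.
  have := hmu x v; rewrite mulmxBr mulmxBl mul_mx_scalar -scalemxAl.
  set Q := _ *m _ *m _; rewrite mxE => h; rewrite -subr_ge0; apply: le_trans h _.
  rewrite le_eqVlt; apply/orP; left; apply/eqP; congr (_ + _); rewrite mxE; congr (- _).
  rewrite mxE; congr (_ * _); rewrite enorm_sqr mxE.
  by apply: eq_bigr => i _; rewrite mxE.
rewrite mxE; under eq_bigr => j _ do rewrite !mxE mulr_suml.
rewrite exchange_big /=; apply: eq_bigr => i _.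
rewrite [Dv v f]/Dv partial_sum => [|j y]; last exact: Ck_diff (Ck_partial j f2) y.
by rewrite mulr_sumr; apply: eq_bigr => j _; rewrite !mxE; ring.
Qed.

Hypothesis hL : forall x y : 'rV[R]_n,
  tensor_norm (nabla d f y - nabla d f x) <= L * enorm (y - x).

Lemma iterD_lipschitz us x y : size us = d ->
  `|iterDv us f y - iterDv us f x| <= L * enorm (y - x) * \prod_(u <- us) enorm u.
Proof.
move=> us_d; pose u (i : 'I_d) := nth 0 us i.
have usE : [seq u i | i <- enum 'I_d] = us.
  rewrite (map_comp (nth 0 us) val) val_enum_ord -[RHS](mkseq_nth 0) us_d; exact.
rewrite -usE -!tensor_app_nabla //.
have -> : tensor_app (nabla d f y) u - tensor_app (nabla d f x) u =
    tensor_app (nabla d f y - nabla d f x) u.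
  rewrite /tensor_app -sumrB; apply: eq_bigr => s _.
  by rewrite !ffunE mulrBl.
apply: le_trans (tensor_app_le _ _) _; rewrite big_map big_enum.
by rewrite ler_wpM2r ?hL // prodr_ge0 // => k _; exact: enorm_ge0.
Qed.

Definition taylor_line_poly x y v : {poly R} :=
  \sum_(k < d.+1) (k`!%:R)^-1 *: line_iterD (y - x) v k f x.

Lemma size_taylor_line_poly x y v : (size (taylor_line_poly x y v) <= d.+1)%N.
Proof.
apply: leq_trans (size_sum _ _ _) _; apply/bigmax_leqP => k _.
apply: leq_trans (size_scale_leq _ _) _; apply: leq_trans (size_line_iterD _ _ _ _ _) _.
by [].
Qed.

Lemma horner_taylor_line_poly x y v s :
  (taylor_line_poly x y v).[s] = taylor f d x (y + s *: v).
Proof.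
rewrite /taylor_line_poly horner_sum; apply: eq_bigr => k _.
have fk : Ck k f by apply: Ck_le hf; rewrite -ltnS.
rewrite hornerZ horner_line_iterD // tensor_app_nabla //; congr (_ * iterDv _ _ _).
have mapE (w : 'rV[R]_n) (l : seq 'I_k) : [seq w | _ <- l] = nseq (size l) w.
  by elim: l => //= _ l ->.
by rewrite mapE size_enum_ord addrAC.
Qed.

(** Differentiating the Taylor polynomial of order [d] in direction [v] gives that of order [d - 1]
    of [Dv v f] with the same centre, so [taylor_remainder] applies to [Dv v f]. One factor
    [enorm (y - x)] comes from the Lipschitz bound, the other [d - 1] from the directions. *)
Lemma taylor_line_poly_deriv_error x y v : (0 < d)%N ->
  `|Dv v f y - (taylor_line_poly x y v)^`().[0]| <=
  L / d`!%:R * enorm (y - x) ^+ d * enorm v.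
Proof.
move=> d0; set h := y - x; have dd : d.-1.+1 = d by rewrite prednK.
have cDv : Ck d.-1 (Dv v f) by apply: Ck_Dv; rewrite dd.
have -> : (taylor_line_poly x y v)^`().[0] = (taylor_line d.-1 (Dv v f) x h).[1].
  rewrite horner_coef0 coef_deriv mulr1n coef_sum big_ord_recl /= coefZ coefC mulr0 add0r.
  rewrite /taylor_line horner_poly dd; apply: eq_bigr => k _.
  have fk : Ck k.+1 f by apply: Ck_le hf.
  rewrite coefZ line_iterD_coef1 // expr1n mulr1 /bump /= add1n factS natrM.
  by rewrite -/h; field; rewrite nat1r !pnatr_eq0 -lt0n fact_gt0.
have yE : y = x + 1 *: h by rewrite scale1r /h addrC subrK.
have us_d : size (rcons (nseq d.-1 h) v) = d by rewrite size_rcons size_nseq.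
have catE : iterDv (nseq d.-1 h) (Dv v f) = iterDv (rcons (nseq d.-1 h) v) f.
  by rewrite /iterDv foldr_rcons.
have lip (t : R) : 0 <= t <= 1 -> `|iterDv (nseq d.-1 h) (Dv v f) (x + t *: h) -
    iterDv (nseq d.-1 h) (Dv v f) x| <= L * enorm h ^+ d * enorm v * t.
  move=> /andP [t0 _]; rewrite catE; apply: le_trans (iterD_lipschitz _ _ us_d) _.
  rewrite (addrC x) addrK enormZ (ger0_norm t0) -cats1 big_cat big_seq1 /=.
  rewrite big_nseq -Monoid.iteropE -[in leRHS]dd exprS /GRing.exp.
  rewrite le_eqVlt; apply/orP; left; apply/eqP; ring.
have := taylor_remainder cDv lip (t := 1); rewrite ler01 lexx expr1n -yE dd.
move=> /(_ isT) h1; apply: le_trans h1 _.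
by rewrite le_eqVlt; apply/orP; left; apply/eqP; ring.
Qed.

Lemma taylor_line_poly_deriv2_error x y v : (1 < d)%N ->
  `|Dv v (Dv v f) y - (taylor_line_poly x y v)^`()^`().[0]| <=
  L / d.-1`!%:R * enorm (y - x) ^+ d.-1 * enorm v ^+ 2.
Proof.
move=> d1; set h := y - x.
have [e dd] : exists e, d = e.+2 by exists d.-2; lia.
have cDv : Ck e (Dv v (Dv v f)) by apply: Ck_Dv; apply: Ck_Dv; rewrite -dd.
have -> : (taylor_line_poly x y v)^`()^`().[0] = (taylor_line e (Dv v (Dv v f)) x h).[1].
  rewrite horner_coef0 !coef_deriv mulr1n coef_sum dd -sumrMnl 2!big_ord_recl /=.
  rewrite !coefZ coefC mulr0 mul0rn add0r /bump /=.
  have -> : (line_iterD h v 1 f x)`_2 = 0.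
    by rewrite nth_default // size_line_iterD.
  rewrite mulr0 mul0rn add0r.
  rewrite /taylor_line horner_poly; apply: eq_bigr => k _.
  have fk : Ck k.+2 f by apply: Ck_le hf; rewrite dd !ltnS -ltnS.
  rewrite coefZ !add1n -mulrnAr line_iterD_coef2 // expr1n mulr1 !factS !natrM -/h.
  move: (iterDv _ _ _) => I.
  have h1 : k.+2%:R != 0 :> R by rewrite pnatr_eq0.
  have h2 : k.+1%:R != 0 :> R by rewrite pnatr_eq0.
  have h3 : k`!%:R != 0 :> R by rewrite pnatr_eq0 -lt0n fact_gt0.
  move: h1 h2 h3; move: (k.+2%:R) (k.+1%:R) (k`!%:R) => a b c a0 b0 c0.
  by field; rewrite a0 b0 c0.
have yE : y = x + 1 *: h by rewrite scale1r /h addrC subrK.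
have us_d : size (nseq e h ++ [:: v; v]) = d by rewrite size_cat size_nseq dd addn2.
have catE : iterDv (nseq e h) (Dv v (Dv v f)) = iterDv (nseq e h ++ [:: v; v]) f.
  by rewrite /iterDv foldr_cat.
have lip (t : R) : 0 <= t <= 1 -> `|iterDv (nseq e h) (Dv v (Dv v f)) (x + t *: h) -
    iterDv (nseq e h) (Dv v (Dv v f)) x| <= L * enorm h ^+ e.+1 * enorm v ^+ 2 * t.
  move=> /andP [t0 _]; rewrite catE; apply: le_trans (iterD_lipschitz _ _ us_d) _.
  rewrite (addrC x) addrK enormZ (ger0_norm t0) big_cat !big_cons big_nil /=.
  have -> : \prod_(u <- nseq e h) enorm u = enorm h ^+ e.
    by rewrite big_nseq -Monoid.iteropE.
  rewrite le_eqVlt; apply/orP; left; apply/eqP; rewrite mulr1 exprS; ring.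
have := taylor_remainder cDv lip (t := 1); rewrite ler01 lexx expr1n -yE dd.
move=> /(_ isT) h1; apply: le_trans h1 _.
by rewrite le_eqVlt; apply/orP; left; apply/eqP => /=; ring.
Qed.

End TaylorErrors.

(** * The regularisation coefficient *)

Section Translation.
Context {R : realType} {n : nat}.
Variable c : 'I_n -> R.

Definition mtrans : mpolynomial R n -> mpolynomial R n :=
  mpoly.mmap (@mpoly.mpolyC n R) (fun i => mvar i + mpoly.mpolyC n (c i)).

(** Moves the position variables only; directions are unaffected by a translation. *)
Definition mtrans2 : mpolynomial R (n + n) -> mpolynomial R (n + n) :=
  mpoly.mmap (@mpoly.mpolyC (n + n) R) (fun k => mvar k + mpoly.mpolyC (n + n)
    (if fintype.split k is inl i then c i else 0)).

Lemma mtransD : {morph mtrans : p q / p + q}.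
Proof. by move=> p q; rewrite /mtrans rmorphD. Qed.

Lemma mtransM : {morph mtrans : p q / p * q}.
Proof. by move=> p q; rewrite /mtrans rmorphM. Qed.

Lemma mtrans_sum (I : Type) (r : seq I) (F : I -> mpolynomial R n) :
  mtrans (\sum_(i <- r) F i) = \sum_(i <- r) mtrans (F i).
Proof. exact: rmorph_sum. Qed.

Lemma mtrans_prod (I : Type) (r : seq I) (F : I -> mpolynomial R n) :
  mtrans (\prod_(i <- r) F i) = \prod_(i <- r) mtrans (F i).
Proof. exact: rmorph_prod. Qed.

Lemma mtransX p k : mtrans (p ^+ k) = mtrans p ^+ k.
Proof. exact: rmorphXn. Qed.

Lemma mtransC a : mtrans (mpoly.mpolyC n a) = mpoly.mpolyC n a.
Proof. by rewrite /mtrans mpoly.mmapC. Qed.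

Lemma mtrans_var i : mtrans (mvar i) = mvar i + mpoly.mpolyC n (c i).
Proof. by rewrite /mtrans /mvar mpoly.mmapX mpoly.mmap1U. Qed.

Lemma mtrans2D : {morph mtrans2 : p q / p + q}.
Proof. by move=> p q; rewrite /mtrans2 rmorphD. Qed.

Lemma mtrans2M : {morph mtrans2 : p q / p * q}.
Proof. by move=> p q; rewrite /mtrans2 rmorphM. Qed.

Lemma mtrans2C a : mtrans2 (mpoly.mpolyC (n + n) a) = mpoly.mpolyC (n + n) a.
Proof. by rewrite /mtrans2 mpoly.mmapC. Qed.

Lemma mtrans2_udir i : mtrans2 (udir i) = udir i.
Proof.
rewrite /mtrans2 /udir /mvar mpoly.mmapX mpoly.mmap1U (unsplitK (inr i)).
by rewrite mpoly.mpolyC0 addr0.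
Qed.

(** The three identities are proved together because the product rules for the gradient and Hessian
    forms mix them. *)
Lemma hessian_mtrans p : [/\ mtrans2 (mlift p) = mlift (mtrans p),
  mtrans2 (gradient_form p) = gradient_form (mtrans p) &
  mtrans2 (hessian_form p) = hessian_form (mtrans p)].
Proof.
have m0 : mtrans2 0 = 0 by rewrite /mtrans2 rmorph0.
have m2 : mtrans2 2 = 2 by rewrite /mtrans2 rmorph_nat.
elim/(@mpoly_ring_ind R n): p => [a|i|p q [p0 p1 p2] [q0 q1 q2]|p q [p0 p1 p2] [q0 q1 q2]].
- by rewrite mtransC mliftC mtrans2C gradient_formC hessian_formC.
- rewrite mtrans_var mliftD mliftC mlift_var gradient_formD hessian_formD.
  rewrite gradient_formC hessian_formC gradient_form_var hessian_form_var !addr0.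
  split => //; last exact: mtrans2_udir.
  by rewrite /mtrans2 /mvar mpoly.mmapX mpoly.mmap1U (unsplitK (inl i)).
- by rewrite mtransD !mliftD !gradient_formD !hessian_formD !mtrans2D p0 p1 p2 q0 q1 q2.
- rewrite mtransM !mliftM !gradient_formM !hessian_formM !mtrans2D !mtrans2M.
  by rewrite m2 p0 p1 p2 q0 q1 q2.
Qed.

Lemma sos_hessian_mtrans p : sos (hessian_form p) -> sos (hessian_form (mtrans p)).
Proof.
have [_ _ <-] := hessian_mtrans p; move=> [s ->].
exists (map mtrans2 s); rewrite big_map /mtrans2 rmorph_sum.
by apply: eq_bigr => q _; rewrite rmorphXn.
Qed.

Lemma mtrans_svar (z z' : 'rV[R]_n) i : c i = z 0 i - z' 0 i ->
  mtrans (svar z i) = svar z' i.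
Proof.
move=> ci; rewrite /svar -!mpoly.mpolyCN mtransD mtransC mtrans_var ci.
by rewrite -addrA -mpoly.mpolyCD; congr (_ + mpoly.mpolyC n _); ring.
Qed.

End Translation.

Section Feasibility.
Context {R : realType} {n : nat}.

Definition regularized_mpoly d q (A : forall k, @tensor R n k) z (t : R) :=
  taylor_mpoly d A z + t *: sqn_mpoly z ^+ q.+1.

(** Feasibility depends on the coefficients alone, so Taylor data taken at different points can be
    compared at one centre. *)
Lemma sos_regularized_translate d q (A : forall k, @tensor R n k) z z' t :
  sos (hessian_form (regularized_mpoly d q A z t)) ->
  sos (hessian_form (regularized_mpoly d q A z' t)).
Proof.
pose c i := z 0 i - z' 0 i.
move=> /(sos_hessian_mtrans c); congr (sos (hessian_form _)).
have hs i : mtrans c (svar z i) = svar z' i by exact: mtrans_svar.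
have mZ a p : mtrans c (a *: p) = a *: mtrans c p.
  by rewrite -!mpoly.mul_mpolyC mtransM mtransC.
rewrite mtransD mZ; congr (_ + _ *: _).
  rewrite /taylor_mpoly mtrans_sum; apply: eq_bigr => k _; rewrite mZ; congr (_ *: _).
  rewrite /form_mpoly mtrans_sum; apply: eq_bigr => s _; rewrite mZ; congr (_ *: _).
  by rewrite mtrans_prod; apply: eq_bigr => i _; exact: hs.
rewrite mtransX mtrans_sum; congr (_ ^+ _); apply: eq_bigr => i _.
by rewrite mtransX hs.
Qed.

Lemma taylor_mpoly_comb d (A B C : forall k, @tensor R n k) z (a b : R) :
  (forall k s, C k s = a * A k s + b * B k s) ->
  taylor_mpoly d C z = a *: taylor_mpoly d A z + b *: taylor_mpoly d B z.
Proof.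
move=> CE; rewrite /taylor_mpoly !scaler_sumr -big_split; apply: eq_bigr => k _ /=.
rewrite !scalerA !(mulrC _ (_^-1)) -!scalerA -scalerDr; congr (_ *: _).
rewrite /form_mpoly !scaler_sumr -big_split; apply: eq_bigr => s _ /=.
by rewrite CE !scalerA -scalerDl.
Qed.

(** The Hessian form is linear in coefficients and parameter jointly, and sums of squares form a
    convex cone. *)
Lemma sos_regularized_convex d q (A B C : forall k, @tensor R n k) z (a t t' : R) :
  0 <= a <= 1 -> (forall k s, C k s = (1 - a) * A k s + a * B k s) ->
  sos (hessian_form (regularized_mpoly d q A z t)) ->
  sos (hessian_form (regularized_mpoly d q B z t')) ->
  sos (hessian_form (regularized_mpoly d q C z ((1 - a) * t + a * t'))).
Proof.
move=> /andP [a0 a1] CE sA sB.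
have a1' : 0 <= 1 - a by rewrite subr_ge0.
have := sosD (sosZ a1' sA) (sosZ a0 sB); congr sos.
rewrite -!hessian_formZ -hessian_formD; congr hessian_form.
rewrite /regularized_mpoly (taylor_mpoly_comb _ _ CE) !scalerDr !scalerA.
by rewrite addrACA -scalerDl.
Qed.

Lemma meval_regularized f d q z t (x : 'rV[R]_n) :
  mpoly.meval (x 0) (regularized_mpoly d q (fun k => nabla k f z) z t) =
  regularized_taylor f d q.+1.*2 t z x.
Proof.
rewrite /regularized_mpoly mpoly.mevalD mpoly.mevalZ meval_taylor rmorphXn /= meval_sqn.
by rewrite /regularized_taylor -exprM mul2n.
Qed.

(** The polynomial hidden in [sos_convex] is determined by its values, hence equals the explicit
    one. *)
Lemma sos_convex_regularizedP f d q z t :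
  sos_convex (regularized_taylor f d q.+1.*2 t z) <->
  sos (hessian_form (regularized_mpoly d q (fun k => nabla k f z) z t)).
Proof.
split=> [[p [pE sp]]|h]; last first.
  exists (regularized_mpoly d q (fun k => nabla k f z) z t).
  by split => // x; rewrite meval_regularized.
rewrite (_ : regularized_mpoly _ _ _ _ _ = p) //.
by apply: meval_inj => x; rewrite meval_regularized pE.
Qed.

End Feasibility.

Section UscMax.
Context {R : realType} {T : topologicalType}.

(* If no point of [K] were maximal, compactness could be applied to the filter of
   the upper level sets of [t] in [K]. *)
Lemma usc_max (K : set T) (t : T -> R) : compact K -> K !=set0 ->
  (forall z, K z -> forall e, 0 < e -> \forall z' \near z, t z' <= t z + e) ->
  exists2 c, K c & forall z, K z -> t z <= t c.
Proof.
move=> cK [k0 Kk0] usc; apply: contrapT => nomax.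
have up c : K c -> exists2 w, K w & t c < t w.
  move=> Kc; apply: contrapT => h; apply: nomax; exists c => // z Kz.
  by rewrite leNgt; apply/negP => lt; apply: h; exists z.
pose F : set_system T := [set S | exists2 w, K w & forall v, K v -> t w <= t v -> S v].
have FF : Filter F.
  split; first by exists k0.
    move=> P Q [w Kw hP] [w' Kw' hQ].
    have [le|/ltW le] := leP (t w) (t w').
      by exists w' => // v Kv h; split; [apply: hP => //; exact: le_trans h|exact: hQ].
    by exists w => // v Kv h; split; [exact: hP|apply: hQ => //; exact: le_trans h].
  by move=> P Q PQ [w Kw hP]; exists w => // v Kv h; apply: PQ; exact: hP.
have /compact_near_coveringP ncK := cK.
have := ncK T F (fun v z => t z < t v) FF.
have prem : forall x, K x -> \forall x' \near x & i \near F, t x' < t i.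
  move=> c Kc; have [w Kw cw] := up c Kc.
  have e0 : 0 < (t w - t c) / 2 by rewrite divr_gt0 ?subr_gt0.
  exists ([set z' | t z' <= t c + (t w - t c) / 2], [set v | K v /\ t w <= t v]).
    by split => /=; [exact: usc|exists w].
  move=> [z v] /= [h1 [_ h2]]; apply: le_lt_trans h1 _; lra.
move=> /(_ prem) [w Kw h].
by have := h w Kw (lexx _) w Kw; rewrite ltxx.
Qed.

End UscMax.

(** * Attainment and semicontinuity of the coefficient *)

Section SosCoefficient.
Context {R : realType} {n : nat}.
Variables (f : 'rV[R]_n -> R) (d q : nat) (mu : R).
Hypotheses (hf : Ck d f) (d2 : (2 <= d)%N) (dq : (d <= (q + q).+2)%N) (mu0 : 0 < mu).
Hypothesis hmu : forall x : 'rV[R]_n, psdmx (hessian f x - mu%:M).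

Let entry_sum (F : forall k, k.-tuple 'I_n -> R) : R :=
  \sum_(k < d.+1) \sum_(s : k.-tuple 'I_n) F k s.

Lemma entry_sum_ge (F : forall k, k.-tuple 'I_n -> R) : (forall k s, 0 <= F k s) ->
  forall k s, (k <= d)%N -> F k s <= entry_sum F.
Proof.
move=> F0 k s kd; rewrite /entry_sum (bigD1 (Ordinal (kd : (k < d.+1)%N))) //= (bigD1 s) //=.
by rewrite -addrA lerDl addr_ge0 ?sumr_ge0 // => i _; rewrite sumr_ge0.
Qed.

Lemma continuous_nabla k (s : k.-tuple 'I_n) : (k <= d)%N ->
  continuous (fun z => nabla k f z s).
Proof.
move=> kd; rewrite (_ : (fun z => _) = foldr partial f s).
  by apply: (@Ck_continuous _ _ 0); apply: Ck_foldr_partial hf; rewrite size_tuple addn0.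
by apply/funext => z; rewrite ffunE.
Qed.

Lemma nabla2_ge z (u : 'rV[R]_n) :
  mu * enorm u ^+ 2 <= tensor_app (nabla 2 f z) (fun=> u).
Proof.
rewrite tensor_app_nabla ?(Ck_le d2 hf) //; last exact: Ck_le hf.
rewrite !enum_ordSl enum_ord0 /=; exact: (hessian_Dv hf d2 hmu).
Qed.

Lemma sos_coef_spec z :
  [/\ 0 <= sos_coef f d q.+1.*2 z,
      sos (hessian_form (regularized_mpoly d q (fun k => nabla k f z) z
        (sos_coef f d q.+1.*2 z))) &
      forall t, 0 <= t ->
        sos (hessian_form (regularized_mpoly d q (fun k => nabla k f z) z t)) ->
        sos_coef f d q.+1.*2 z <= t].
Proof.
pose A k := nabla k f z.
have B0 : 0 <= entry_sum (fun k s => `|A k s|).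
  by apply: sumr_ge0 => k _; apply: sumr_ge0.
have [T T0 hT] := sos_hessian_taylor (n := n) mu0 B0 d2 dq.
have sT : sos (hessian_form (regularized_mpoly d q A z T)).
  apply: hT => //; first exact: nabla2_ge.
  by move=> k s kd; apply: (@entry_sum_ge (fun k s => `|A k s|)).
have lin t : hessian_form (regularized_mpoly d q A z t) =
    hessian_form (taylor_mpoly d A z) + t *: hessian_form (sqn_mpoly z ^+ q.+1).
  by rewrite hessian_formD hessian_formZ.
have [|t0 [t00 st0 mint0]] := @sos_pencil_min R _ (hessian_form (taylor_mpoly d A z))
    (hessian_form (sqn_mpoly z ^+ q.+1)).
  by exists T; rewrite -?lin.
have -> : sos_coef f d q.+1.*2 z = t0.
  apply: set_min_eq; first by split => //; apply/sos_convex_regularizedP; rewrite lin.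
  move=> t [t0' /sos_convex_regularizedP]; rewrite lin; exact: mint0.
split; [exact: t00|by rewrite lin|move=> t t0' st].
by apply: mint0; [exact: t0'|rewrite -lin].
Qed.

Lemma tensor2_small (D : @tensor R n 2) (eta : R) (u : 'rV[R]_n) :
  (forall s, `|D s| <= eta) ->
  `|tensor_app D (fun=> u)| <= (n * n)%:R * eta * enorm u ^+ 2.
Proof.
move=> De; rewrite tensor_app2.
apply: le_trans (ler_norm_sum _ _ _) _.
apply: le_trans (_ : _ <= \sum_(i < n) \sum_(j < n) eta * enorm u ^+ 2) _.
  apply: ler_sum => i _; apply: le_trans (ler_norm_sum _ _ _) _.
  apply: ler_sum => j _; rewrite !normrM expr2; apply: ler_pM => //.
  by apply: ler_pM => //; exact: coord_le_enorm.
by rewrite !sumr_const !card_ord -mulrnA -[leLHS]mulr_natl mulrA.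
Qed.

(* The coefficients of the Taylor polynomial at [z'] are a convex combination of
   those at [z], with weight close to [1], and of a bounded perturbation of them
   for which a fixed parameter [T] is feasible. *)
Lemma sos_coef_usc z (e : R) : 0 < e ->
  \forall z' \near z, sos_coef f d q.+1.*2 z' <= sos_coef f d q.+1.*2 z + e.
Proof.
move=> e0; have [t00 st0 _] := sos_coef_spec z.
set t0 := sos_coef f d q.+1.*2 z in t00 st0 *.
pose A k := nabla k f z.
pose B := entry_sum (fun k s => `|A k s|).
have B0 : 0 <= B by apply: sumr_ge0 => k _; apply: sumr_ge0.
have hB k s : (k <= d)%N -> `|A k s| <= B by apply: (@entry_sum_ge (fun k s => `|A k s|)).
have B10 : 0 <= B + 1 by rewrite addr_ge0.
(* [T] is taken for half the convexity and for entries larger by 1, which leaves room for the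
   perturbation [D] below. *)
have mu20 : 0 < mu / 2 by rewrite divr_gt0.
have [T T0 hT] := sos_hessian_taylor (n := n) mu20 B10 d2 dq.
pose a := e / (e + T + 1).
have w0 : 0 < e + T + 1 by rewrite addr_gt0 // ltr_wpDr.
have a0 : 0 < a by rewrite divr_gt0.
have a1 : a <= 1 by rewrite ler_pdivrMr // mul1r; lra.
have aT : a * T <= e.
  by rewrite /a mulrAC ler_pdivrMr // ler_pM2l //; lra.
pose nn : R := (n * n)%:R.
have nn0 : 0 <= nn by [].
(* Entries of size at most [w] change the quadratic form by at most [mu / 2 * |u|^2], and [w <= 1]
   keeps the entries below [B + 1]. *)
pose w := mu / (mu + 2 * nn).
have m0 : 0 < mu + 2 * nn by rewrite ltr_pwDl // mulr_ge0.
have w_0 : 0 < w by rewrite divr_gt0.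
have w_1 : w <= 1 by rewrite ler_pdivrMr // mul1r lerDl mulr_ge0.
have w_n : nn * w <= mu / 2.
  rewrite /w mulrA ler_pdivrMr //.
  have := mulr_ge0 (ltW mu0) (ltW mu0); lra.
pose dist z' := entry_sum (fun k s => `|nabla k f z' s + -1 * A k s|).
have cdist : continuous dist.
  apply: continuous_sumr => k; apply: continuous_sumr => s; apply: continuous_normr.
  apply: continuous_addr; last exact: continuous_cst.
  by apply: continuous_nabla; rewrite -ltnS.
have dz : dist z = 0.
  by apply: big1 => k _; apply: big1 => s _; rewrite mulN1r subrr normr0.
have aw0 : 0 < a * w by rewrite mulr_gt0.
have /cvgrPdist_lt /(_ _ aw0) := cdist z.
apply: filterS => z'; rewrite dz sub0r normrN => hz'.
have hd k s : (k <= d)%N -> `|nabla k f z' s - A k s| <= a * w.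
  move=> kd; apply: le_trans (le_trans (ler_norm _) (ltW hz')).
  have := @entry_sum_ge (fun k s => `|nabla k f z' s + -1 * A k s|) _ k s kd.
  by rewrite mulN1r; apply.
have [_ _ mint] := sos_coef_spec z'.
(* Dividing by [a] makes the tensors at [z'] equal to [(1 - a) A + a (A + D)], while [|D| <= w] once
   the entries have moved by at most [a * w]. *)
pose D k : @tensor R n k := [ffun s => a^-1 * (nabla k f z' s - A k s)].
have hD k s : (k <= d)%N -> `|D k s| <= w.
  move=> kd; rewrite ffunE normrM gtr0_norm ?invr_gt0 // ler_pdivrMl //.
  exact: hd.
pose A'' k : @tensor R n k := [ffun s => A k s + D k s].
apply: le_trans (mint ((1 - a) * t0 + a * T) _ _) _.
- by rewrite addr_ge0 // mulr_ge0 ?subr_ge0 // ltW.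
- apply: (@sos_regularized_convex _ _ _ _ A A'').
  + by rewrite (ltW a0).
  + move=> k s; rewrite !ffunE; field; by rewrite gt_eqF.
  + exact: sos_regularized_translate st0.
  apply: hT => //; last first.
    move=> k s kd; rewrite ffunE; apply: le_trans (ler_normD _ _) _.
    by apply: lerD; [exact: hB|apply: le_trans (hD _ _ kd) w_1].
  move=> u; have -> : tensor_app (A'' 2) (fun=> u) =
      tensor_app (A 2) (fun=> u) + tensor_app (D 2) (fun=> u).
    by rewrite /tensor_app -big_split; apply: eq_bigr => s _; rewrite ffunE mulrDl.
  have h1 := nabla2_ge z u.
  have h2 := tensor2_small u (fun s => hD 2 s d2); rewrite -/nn in h2.
  have h3 : nn * w * enorm u ^+ 2 <= mu / 2 * enorm u ^+ 2 by rewrite ler_wpM2r ?sqr_ge0.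
  have := ler_norm (- tensor_app (D 2) (fun=> u)); rewrite normrN => h4.
  rewrite -/(A 2) in h1; lra.
- have : 0 <= a * t0 by rewrite mulr_ge0 // ltW.
  rewrite mulrBl mul1r; lra.
Qed.

Lemma sos_coef_max (c : 'rV[R]_n) (r : R) : 0 <= r ->
  exists2 z, enorm (z - c) <= r & forall z', enorm (z' - c) <= r ->
    sos_coef f d q.+1.*2 z' <= sos_coef f d q.+1.*2 z.
Proof.
move=> r0; pose K := [set z : 'rV[R]_n | enorm (z - c) ^+ 2 <= r ^+ 2].
have KP z : K z <-> enorm (z - c) <= r.
  by rewrite /K /= ler_sqr ?nnegrE ?enorm_ge0.
have cK : compact K.
  apply: (@compact_of_bounded_coords _ _ _ (r + enorm c)).
    by apply: closed_level_le; [exact: continuous_enorm_sqr|exact: continuous_cst].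
  move=> z /KP zr i; rewrite (_ : z 0 i = (z - c) 0 i + c 0 i); last by rewrite !mxE subrK.
  apply: le_trans (ler_normD _ _) _; apply: lerD; last exact: coord_le_enorm.
  exact: le_trans (coord_le_enorm _ _) zr.
have K0 : K !=set0.
  by exists c; apply/KP; rewrite subrr -(scale0r c) enormZ normr0 mul0r.
have [z /KP zr zmax] := usc_max cK K0 (fun z _ e e0 => sos_coef_usc z e0).
by exists z => // z' /KP; exact: zmax.
Qed.

End SosCoefficient.

(** * Minimisation of the regularised model *)

Section ConvexPolynomials.
Context {R : realType}.
Implicit Types p q : {poly R}.

(** The test points lie in [[0, 1]], so agreement on a segment suffices; [psi_minimizer_unique] uses
    this. *)
Lemma horner_inj p q : (forall i : nat, p.[i.+1%:R^-1] = q.[i.+1%:R^-1]) -> p = q.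
Proof.
move=> pq; apply/eqP; rewrite -subr_eq0; apply/eqP.
apply: (@roots_geq_poly_eq0 _ _ [seq i.+1%:R^-1 | i <- iota 0 (size (p - q))]).
- by apply/allP => _ /mapP [i _ ->]; rewrite rootE !hornerE pq subrr.
- rewrite map_inj_uniq ?iota_uniq // => i j /invr_inj /eqP.
  by rewrite eqr_nat eqSS => /eqP.
- by rewrite size_map size_iota.
Qed.

Lemma poly_mvt_le p (a b : R) : a <= b -> (forall t, 0 <= p^`().[t]) -> p.[a] <= p.[b].
Proof.
rewrite le_eqVlt => /orP [/eqP -> //|ab] p0.
have [c _ e] := polyrcf.poly_mvt p ab.
by rewrite -subr_ge0 e mulr_ge0 // subr_ge0 ltW.
Qed.

Lemma convex_tangent p (a b : R) : a < b -> (forall t, 0 <= p^`()^`().[t]) ->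
  p^`().[a] * (b - a) <= p.[b] - p.[a].
Proof.
move=> ab p0; have [c] := polyrcf.poly_mvt p ab.
rewrite in_itv /= => /andP [ac _] ->; rewrite ler_wpM2r ?subr_ge0 ?(ltW ab) //.
exact: poly_mvt_le (ltW ac) p0.
Qed.

Lemma convex_chord p (t : R) : 0 <= t <= 1 -> (forall t, 0 <= p^`()^`().[t]) ->
  p.[t] <= Num.max p.[0] p.[1].
Proof.
move=> /andP [t0 t1] p0; rewrite le_max.
move: t0; rewrite le_eqVlt => /orP [/eqP <-|t0]; first by rewrite lexx.
move: t1; rewrite le_eqVlt => /orP [/eqP ->|t1]; first by rewrite lexx orbT.
have [//|h0 /=] := leP p.[t] p.[0].
have [c] := polyrcf.poly_mvt p t0; rewrite in_itv /= subr0 => /andP [c0 ct] e.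
have pc : 0 < p^`().[c] by rewrite -(pmulr_lgt0 _ t0) -e subr_gt0.
have pt : 0 <= p^`().[t] by apply: le_trans (ltW pc) _; apply: poly_mvt_le => //; exact: ltW.
rewrite -subr_ge0; apply: le_trans (convex_tangent t1 p0).
by rewrite mulr_ge0 // subr_ge0 ltW.
Qed.

Lemma deriv_le0_at_min p : (forall t, 0 <= t <= 1 -> p.[1] <= p.[t]) -> p^`().[1] <= 0.
Proof.
move=> pmin; rewrite leNgt; apply/negP => p1.
have [e e0 he] := polyrcf.poly_cont 1 p^`() p1.
pose t : R := Num.max 0 (1 - e / 2).
have t1 : t < 1 by rewrite gt_max ltr01 /=; lra.
have t0 : 0 <= t by rewrite le_max lexx.
have te : 1 - e / 2 <= t by rewrite le_max lexx orbT.
have [c] := polyrcf.poly_mvt p t1; rewrite in_itv /= => /andP [tc c1] E.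
have : `|p^`().[c] - p^`().[1]| < p^`().[1].
  by apply: he; rewrite ltr_norml; apply/andP; split; lra.
rewrite ltr_norml => /andP [h _].
have pc : 0 < p^`().[c] by lra.
have : 0 < p.[1] - p.[t] by rewrite E mulr_gt0 // subr_gt0.
by rewrite subr_gt0 ltNge pmin // t0 ltW.
Qed.

End ConvexPolynomials.

Section SosConvexFunctions.
Context {R : realType} {n : nat}.

Lemma continuous_sos_convex (g : 'rV[R]_n -> R) : sos_convex g -> continuous g.
Proof.
move=> [p [gp _]]; have -> : g = fun x : 'rV[R]_n => mpoly.meval (x 0) p by apply/funext.
elim/(@mpoly_ring_ind R n): p {gp} => [c|i|p q IHp IHq|p q IHp IHq].
- rewrite (_ : (fun x => _) = fun=> c); first exact: continuous_cst.
  by apply/funext => x; rewrite mpoly.mevalC.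
- rewrite (_ : (fun x => _) = fun x : 'rV[R]_n => x 0 i); first exact: coord_continuous.
  by apply/funext => x; rewrite /mvar mpoly.mevalXU.
- rewrite (_ : (fun x => _) = fun x : 'rV[R]_n => mpoly.meval (x 0) p + mpoly.meval (x 0) q).
    exact: continuous_addr.
  by apply/funext => x; rewrite mpoly.mevalD.
- rewrite (_ : (fun x => _) = fun x : 'rV[R]_n => mpoly.meval (x 0) p * mpoly.meval (x 0) q).
    exact: continuous_mulr.
  by apply/funext => x; rewrite mpoly.mevalM.
Qed.

Lemma horner_sum_sqr_ge0 (s : seq {poly R}) (t : R) : 0 <= (\sum_(q <- s) q ^+ 2).[t].
Proof. by rewrite horner_sum; apply: sumr_ge0 => q _; rewrite horner_exp sqr_ge0. Qed.

Lemma sos_convex_quasi (g : 'rV[R]_n -> R) (a b : 'rV[R]_n) (t : R) : sos_convex g ->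
  0 <= t <= 1 -> g (a + t *: (b - a)) <= Num.max (g a) (g b).
Proof.
move=> /(sos_convex_line a (b - a)) [G [s [gG Gs]]] t01.
have := convex_chord (p := G) t01; rewrite Gs => /(_ (horner_sum_sqr_ge0 s)).
by rewrite -!gG scale0r addr0 scale1r addrCA subrr addr0.
Qed.

End SosConvexFunctions.

(** [q.*2.+1] is [d' - 1], the exponent left when [|y - z|^d'] is differentiated. The alternative
    depends on the parity of [d] and is the origin of [Num.max r 1]. *)
Lemma double_between d q : (d < q.+1.*2)%N -> (q.+1.*2 <= d.+2)%N ->
  q.*2.+1 = d \/ q.*2.+1 = d.+1.
Proof. lia. Qed.

(** * The regularised model along lines and its minimisers *)

Section Psi.
Context {R : realType} {n : nat}.
Variables (f : 'rV[R]_n -> R) (d q : nat) (mu L : R).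
Hypotheses (hf : Ck d f) (d2 : (2 <= d)%N) (dq : (d <= (q + q).+2)%N) (mu0 : 0 < mu).
Hypothesis L0 : 0 < L.
Hypothesis hmu : forall x : 'rV[R]_n, psdmx (hessian f x - mu%:M).
Hypothesis hL : forall x y : 'rV[R]_n,
  tensor_norm (nabla d f y - nabla d f x) <= L * enorm (y - x).

Let d' := q.+1.*2.
Let k : R := q.+1%:R.

Definition sqn_line (h v : 'rV[R]_n) : {poly R} :=
  (enorm h ^+ 2)%:P + (2 * dotr h v) *: 'X + (enorm v ^+ 2) *: 'X^2.

(** Explicit, so that degree and derivatives at 0 can be computed; the sum-of-squares property is
    transferred from [sos_convex_line] by equality of values. *)
Definition psi_line (z y v : 'rV[R]_n) : {poly R} :=
  taylor_line_poly f d z y v + sos_coef f d d' z *: sqn_line (y - z) v ^+ q.+1.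

Lemma horner_sqn_line h v t : (sqn_line h v).[t] = enorm (h + t *: v) ^+ 2.
Proof.
by rewrite enorm_line /sqn_line !(hornerD, hornerZ, hornerC, hornerX, hornerXn); ring.
Qed.

Lemma horner_psi_line z y v t : (psi_line z y v).[t] = psi f d d' z (y + t *: v).
Proof.
rewrite /psi_line hornerD hornerZ horner_exp horner_taylor_line_poly // horner_sqn_line.
by rewrite /psi /regularized_taylor -exprM mul2n addrAC.
Qed.

Lemma size_psi_line z y v : (size (psi_line z y v) <= d'.+1)%N.
Proof.
apply: leq_trans (size_polyD _ _) _; rewrite geq_max; apply/andP; split.
  apply: leq_trans (size_taylor_line_poly _ _ _ _ _) _.
  by rewrite ltnS (leq_trans dq) // /d' -addnn addSn addnS.
apply: leq_trans (size_scale_leq _ _) _; apply: leq_trans (size_poly_exp_leq _ _) _.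
have s3 : (size (sqn_line (y - z) v) <= 3)%N.
  apply: leq_trans (size_polyD _ _) _; rewrite geq_max; apply/andP; split.
    apply: leq_trans (size_polyD _ _) _; rewrite geq_max; apply/andP; split.
      by apply: leq_trans (size_polyC_leq1 _) _.
    by apply: leq_trans (size_scale_leq _ _) _; rewrite size_polyX.
  by apply: leq_trans (size_scale_leq _ _) _; rewrite size_polyXn.
rewrite ltnS /d' -mul2n leq_mul2r /=.
by move: s3; case: (size _).
Qed.

Lemma sos_coef_ge0 z : 0 <= sos_coef f d d' z.
Proof. by have [] := sos_coef_spec hf d2 dq mu0 hmu z. Qed.

Lemma sos_convex_psi z : sos_convex (psi f d d' z).
Proof.
by have [_ h _] := sos_coef_spec hf d2 dq mu0 hmu z; exact/sos_convex_regularizedP.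
Qed.

Lemma psi_line_sos z y v :
  exists s : seq {poly R}, (psi_line z y v)^`()^`() = \sum_(q <- s) q ^+ 2.
Proof.
have [G [s [hG Gs]]] := sos_convex_line y v (sos_convex_psi z).
exists s; rewrite (_ : psi_line z y v = G) //.
by apply: horner_inj => i; rewrite horner_psi_line hG.
Qed.

Lemma psi_line_convex z y v t : 0 <= (psi_line z y v)^`()^`().[t].
Proof. by have [s ->] := psi_line_sos z y v; exact: horner_sum_sqr_ge0. Qed.

Lemma psi_line_increment z y v : (psi_line z y v)^`()^`().[0] <=
  k ^+ 2 * ((psi_line z y v)^`().[1] - (psi_line z y v)^`().[0]).
Proof.
have [s hs] := psi_line_sos z y v.
exact: (deriv_increment_ge (size_psi_line z y v) hs).
Qed.

Lemma sqn_line_deriv0 h v : (sqn_line h v)^`().[0] = 2 * dotr h v.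
Proof.
rewrite /sqn_line !(derivD, derivZ, derivC, derivX, derivXn).
by rewrite !(hornerD, hornerZ, hornerC, hornerX); ring.
Qed.

Lemma sqn_line_deriv2 h v : (sqn_line h v)^`()^`().[0] = 2 * enorm v ^+ 2.
Proof.
rewrite /sqn_line !(derivD, derivZ, derivC, derivX, derivXn).
by rewrite !(hornerD, hornerZ, hornerC, hornerX); ring.
Qed.

Lemma sqn_lineX_deriv0 h v : `|(sqn_line h v ^+ q.+1)^`().[0]| <=
  d'%:R * enorm h ^+ q.*2.+1 * enorm v.
Proof.
rewrite deriv_exp hornerMn hornerM horner_exp sqn_line_deriv0 horner_sqn_line scale0r addr0.
rewrite -[_ *+ q.+1]mulr_natr !normrM normrX !normr_nat /=.
have -> : d'%:R = 2 * q.+1%:R :> R by rewrite /d' -mul2n natrM.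
rewrite (ger0_norm (sqr_ge0 (enorm h))) -exprM mul2n exprS.
have := dotr_le h v; move: (`|dotr h v|) (enorm h) (enorm v) (enorm_ge0 h) => a b c b0 abc.
have -> : 2 * q.+1%:R * (b * b ^+ q.*2) * c = 2 * (b * c) * b ^+ q.*2 * q.+1%:R by ring.
by rewrite !ler_wpM2r // ?exprn_ge0 // ler_wpM2l.
Qed.

Lemma sqn_lineX_deriv2 h v : 0 <= (sqn_line h v ^+ q.+1)^`()^`().[0].
Proof.
rewrite deriv_exp derivMn hornerMn mulrn_wge0 // derivM deriv_exp hornerD !hornerM /=.
rewrite hornerMn hornerM !horner_exp sqn_line_deriv2 horner_sqn_line.
apply: addr_ge0; first by rewrite !mulr_ge0 ?exprn_ge0 ?enorm_ge0.
rewrite mulrnAr mulrn_wge0 // mulrA -expr2 mulr_ge0 ?sqr_ge0 //.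
by rewrite !exprn_ge0 ?enorm_ge0.
Qed.

Lemma psi_line_deriv0 z y v : `|Dv v f y - (psi_line z y v)^`().[0]| <=
  (L / d`!%:R * enorm (y - z) ^+ d +
   sos_coef f d d' z * d'%:R * enorm (y - z) ^+ q.*2.+1) * enorm v.
Proof.
rewrite /psi_line derivD derivZ hornerD hornerZ opprD addrA.
apply: le_trans (ler_normB _ _) _; rewrite mulrDl; apply: lerD.
  by apply: taylor_line_poly_deriv_error => //; exact: ltnW.
rewrite normrM (ger0_norm (sos_coef_ge0 z)) -!mulrA ler_wpM2l ?sos_coef_ge0 //.
by rewrite mulrA; exact: sqn_lineX_deriv0.
Qed.

Lemma psi_line_deriv2 z y v :
  (mu - L / d.-1`!%:R * enorm (y - z) ^+ d.-1) * enorm v ^+ 2 <=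
  (psi_line z y v)^`()^`().[0].
Proof.
rewrite /psi_line !derivD !derivZ hornerD hornerZ.
have h1 := taylor_line_poly_deriv2_error hf hL z y v d2.
have h2 := hessian_Dv hf d2 hmu y v.
have h3 := mulr_ge0 (sos_coef_ge0 z) (sqn_lineX_deriv2 (y - z) v).
move: h1; rewrite ler_norml => /andP [_]; lra.
Qed.

(* At the centre [z] the line polynomial has second derivative at least
   [mu |v|^2], so its slope grows by [mu |v|^2 / k^2] between [z] and [z + v]
   and the quadratic growth of [psi] follows by convexity. *)
Lemma psi_growth z (w : 'rV[R]_n) :
  psi f d d' z z + Dv w f z + mu / (4 * k ^+ 2) * enorm w ^+ 2 <= psi f d d' z (z + w).
Proof.
(* Two unit steps along [v]: the tangent at 0 serves [[0, 1]], the tangent at 1 serves [[1, 2]], and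
   the second slope exceeds the first by the increment bound. The 4 is [|w|^2 = 4 |v|^2]. *)
pose v := 2^-1 *: w; pose P := psi_line z z v.
have vw : 2 *: v = w by rewrite scalerA mulfV ?scale1r ?pnatr_eq0.
have Pc := psi_line_convex z z v.
have k0 : 0 < k ^+ 2 by rewrite exprn_gt0 // ltr0Sn.
have e0 : enorm (z - z) = 0 by rewrite subrr -(scale0r z) enormZ normr0 mul0r.
have P0 : P^`().[0] = Dv v f z.
  have := psi_line_deriv0 z z v; rewrite e0 !expr0n [d == 0%N]gtn_eqF ?(ltnW d2) //=.
  by rewrite !mulr0 addr0 mul0r normr_le0 subr_eq0 => /eqP <-.
have P2 : mu * enorm v ^+ 2 <= P^`()^`().[0].
  apply: le_trans (psi_line_deriv2 z z v).
  by rewrite e0 expr0n [d.-1 == 0%N]gtn_eqF ?mulr0 ?subr0 // -ltnS prednK // ltnW.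
have h1 := convex_tangent (p := P) ltr01 Pc.
have h2 := convex_tangent (p := P) (ltr1n R 2) Pc.
have h3 := psi_line_increment z z v; rewrite -/P in h3.
have D2 : Dv w f z = 2 * Dv v f z.
  by rewrite -vw /Dv mulr_sumr; apply: eq_bigr => i _; rewrite mxE mulrA.
have E2 : enorm w ^+ 2 = 4 * enorm v ^+ 2 by rewrite -vw enormZ exprMn ger0_norm //; ring.
have Pz : P.[0] = psi f d d' z z by rewrite /P horner_psi_line scale0r addr0.
have Pw : P.[2] = psi f d d' z (z + w) by rewrite /P horner_psi_line vw.
rewrite -Pz -Pw D2 E2 -P0.
have h4 : mu / (4 * k ^+ 2) * (4 * enorm v ^+ 2) <= P^`().[1] - P^`().[0].
  have -> : mu / (4 * k ^+ 2) * (4 * enorm v ^+ 2) = mu * enorm v ^+ 2 / k ^+ 2.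
    by move: (k ^+ 2) k0 => a a0; field; rewrite gt_eqF.
  by rewrite ler_pdivrMr // [leRHS]mulrC; exact: le_trans P2 h3.
move: h1 h2 h4; rewrite subr0 mulr1 (_ : 2 - 1 = 1 :> R) ?mulr1; last by ring.
move: (mu / _ * _) => X h1 h2 h4; lra.
Qed.

Lemma Dv_ge z w : - (enorm (\row_i partial i f z) * enorm w) <= Dv w f z.
Proof.
have -> : Dv w f z = dotr (\row_i partial i f z) w.
  by apply: eq_bigr => i _; rewrite mxE mulrC.
have := dotr_le (\row_i partial i f z) w.
by rewrite ler_norml => /andP [].
Qed.

Lemma psi_coercive z (m : R) : exists M, forall y, psi f d d' z y <= m -> enorm (y - z) <= M.
Proof.
pose c := mu / (4 * k ^+ 2); pose G := enorm (\row_i partial i f z).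
have c0 : 0 < c by rewrite divr_gt0 // mulr_gt0 // exprn_gt0 // ltr0Sn.
pose E := `|m - psi f d d' z z| + 1.
have E0 : 0 < E by rewrite ltr_pwDr.
(* Beyond this radius [c |w|^2] exceeds [(G + E) |w|], which pays for the linear term and, as
   [|w| > 1], for [E]. *)
exists (1 + (G + E) / c) => y ym; rewrite leNgt; apply/negP => big.
set w := y - z in big.
have w1 : 1 < enorm w.
  by apply: le_lt_trans big; rewrite lerDl divr_ge0 ?addr_ge0 ?enorm_ge0 // ltW.
have w2 : G + E < c * enorm w.
  rewrite mulrC -ltr_pdivrMr //; apply: le_lt_trans big.
  by rewrite lerDr.
have zw : z + w = y by rewrite /w addrC subrK.
have := psi_growth z w; rewrite zw -/c => h.
have hD := Dv_ge z w; rewrite -/G in hD.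
have h3 : E <= E * enorm w by rewrite ler_peMr // ltW.
have h4 : (G + E) * enorm w <= c * enorm w ^+ 2.
  by rewrite expr2 mulrA ler_wpM2r ?enorm_ge0 // ltW.
have := ler_norm (m - psi f d d' z z); rewrite /E in h3 h4 *; lra.
Qed.

Lemma continuous_psi z : continuous (psi f d d' z).
Proof. exact: continuous_sos_convex (sos_convex_psi z). Qed.

Section Minimization.
Variable C : set 'rV[R]_n.
Hypothesis cC : closed C.
Hypothesis convC : forall a b t, C a -> C b -> 0 <= t <= 1 -> C (a + t *: (b - a)).

Lemma psi_minimizer_exists z : C !=set0 -> exists x, minimizer (psi f d d' z) C x.
Proof.
move=> [c Cc]; pose S := C `&` [set y | psi f d d' z y <= psi f d d' z c].
have [M hM] := psi_coercive z (psi f d d' z c).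
have cS : closed S.
  apply: closedI => //; apply: closed_level_le; last exact: continuous_cst.
  exact: continuous_psi.
have bS y : S y -> forall i, `|y 0 i| <= M + enorm z.
  move=> [_ /hM yz] i; rewrite (_ : y 0 i = (y - z) 0 i + z 0 i); last by rewrite !mxE subrK.
  apply: le_trans (ler_normD _ _) _; apply: lerD; last exact: coord_le_enorm.
  exact: le_trans (coord_le_enorm _ _) yz.
have S0 : S !=set0 by exists c; split => //=.
have [x [Cx xc] xmin] := rV_argmin S0 cS bS (@continuous_psi z).
exists x; split => // y Cy.
have [yc|/ltW yc] := leP (psi f d d' z y) (psi f d d' z c); first by apply: xmin.
exact: le_trans yc.
Qed.

Lemma psi_minimizer_unique z a b : minimizer (psi f d d' z) C a ->
  minimizer (psi f d d' z) C b -> a = b.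
Proof.
move=> [Ca amin] [Cb bmin]; apply/eqP; rewrite eq_sym -subr_eq0; apply/eqP.
set v := b - a; set m := psi f d d' z a.
have bm : psi f d d' z b = m by apply/eqP; rewrite eq_le bmin ?amin.
pose P := psi_line z a v.
have P1 : P.[1] = m by rewrite horner_psi_line scale1r /v addrCA subrr addr0.
have P0 : P.[0] = m by rewrite horner_psi_line scale0r addr0.
have Pm : P = m%:P.
  apply: horner_inj => i; rewrite hornerC.
  have i01 : 0 <= (i.+1%:R^-1 : R) <= 1 by rewrite invr_ge0 ler0n invf_le1 ?ltr0n // ler1n.
  apply/eqP; rewrite eq_le; apply/andP; split.
    by have := convex_chord i01 (psi_line_convex z a v); rewrite -/P P0 P1 maxxx.
  by rewrite horner_psi_line amin //; exact: convC.
have [M hM] := psi_coercive z m.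
have hs s : enorm (a + s *: v - z) <= M.
  by apply: hM; rewrite -horner_psi_line -/P Pm hornerC.
apply/rowP => i; rewrite [RHS]mxE; apply/eqP; apply: contraT => vi.
(* Moves coordinate [i] out of the sublevel set, on which it is at most [M] away from [z], although
   [P] is constant along the line. *)
set s := (M + 1 - (a 0 i - z 0 i)) / v 0 i.
have sE : (a + s *: v - z) 0 i = M + 1.
  have -> : (a + s *: v - z) 0 i = a 0 i + s * v 0 i - z 0 i by rewrite !mxE.
  by rewrite /s divfK //; ring.
have := le_trans (coord_le_enorm _ i) (hs s); rewrite sE.
by move=> /(le_trans (ler_norm _)); lra.
Qed.

Lemma directional_derivative_ge0 x y : minimizer f C x -> C y -> 0 <= Dv (y - x) f x.
Proof.
move=> [Cx xmin] Cy; rewrite leNgt; apply/negP => neg; set v := y - x in neg.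
have e0 : 0 < - Dv v f x by rewrite oppr_gt0.
have f1 : Ck 1 f by apply: Ck_le hf; exact: ltnW.
have cD : continuous (Dv v f) by exact: Ck_continuous (Ck_Dv v f1).
have [t t0 ht] := continuous_limit_eq x v 0 e0 cD.
pose t' := Num.min t 1.
have t'0 : 0 < t' by rewrite lt_min t0 ltr01.
have t'1 : t' <= 1 by rewrite ge_min lexx orbT.
have [s /andP [s0 st] E] := line_MVT x v t'0 (Ck_diff f1).
have h1 : 0 <= Dv v f (x + s *: v).
  rewrite -(pmulr_rge0 _ t'0) -E subr_ge0; apply: xmin.
  by apply: convC => //; rewrite (ltW t'0).
have st2 : 0 < s < t by rewrite s0 (lt_le_trans st) // ge_min lexx.
have := ht s s st2 st2; rewrite scaler0 addr0 ltr_norml => /andP [_]; lra.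
Qed.

Lemma psi_minimizer_distance z xstar xplus (r : R) :
  enorm (z - xstar) <= r -> L / d.-1`!%:R * r ^+ d.-1 <= mu / 2 ->
  (d < d')%N -> (d' <= d.+2)%N ->
  minimizer f C xstar -> minimizer (psi f d d' z) C xplus ->
  enorm (xplus - xstar) <= k ^+ 2 * (2 / mu) *
    (L / d`!%:R + sos_coef f d d' z * d'%:R * Num.max r 1) * enorm (z - xstar) ^+ d.
Proof.
move=> zr rL dd' d'd xsmin [Cp pmin].
have Cs := xsmin.1.
set v := xplus - xstar; set h := enorm (z - xstar) in zr *; pose P := psi_line z xstar v.
have hE : enorm (xstar - z) = h.
  by rewrite -opprB -scaleN1r enormZ normrN normr1 mul1r.
have h0 : 0 <= h by exact: enorm_ge0.
have t0 := sos_coef_ge0 z; set t := sos_coef f d d' z in t0 *.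
have P1 : P^`().[1] <= 0.
  apply: deriv_le0_at_min => s s01; rewrite !horner_psi_line scale1r /v.
  by rewrite [xstar + (xplus - xstar)]addrC subrK; apply: pmin; exact: convC.
have F0 := directional_derivative_ge0 xsmin Cp; rewrite -/v in F0.
have := psi_line_deriv0 z xstar v; rewrite hE -/P -/t.
rewrite ler_norml => /andP [_ D1].
have D2 := psi_line_deriv2 z xstar v; rewrite hE -/P in D2.
have inc := psi_line_increment z xstar v; rewrite -/P in inc.
have hr : L / d.-1`!%:R * h ^+ d.-1 <= mu / 2.
  apply: le_trans rL; rewrite ler_wpM2l ?divr_ge0 ?(ltW L0) //.
  by rewrite lerXn2r ?nnegrE // (le_trans h0).
have v2 : 0 <= enorm v ^+ 2 by exact: sqr_ge0.
have D3 : mu / 2 * enorm v ^+ 2 <= P^`()^`().[0].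
  by apply: le_trans D2; rewrite ler_wpM2r //; lra.
set W := (L / d`!%:R + t * d'%:R * Num.max r 1) * h ^+ d.
have hW : L / d`!%:R * h ^+ d + t * d'%:R * h ^+ q.*2.+1 <= W.
  rewrite /W mulrDl lerD2l -[leRHS]mulrA ler_wpM2l ?mulr_ge0 //.
  have [->|->] := double_between dd' d'd.
    by rewrite ler_peMl ?exprn_ge0 // le_max lexx orbT.
  by rewrite exprS ler_wpM2r ?exprn_ge0 // le_max zr.
have W0 : 0 <= W.
  by apply: le_trans hW; rewrite addr_ge0 // ?mulr_ge0 ?exprn_ge0 ?invr_ge0 // ltW.
have k0 : 0 <= k ^+ 2 by exact: sqr_ge0.
have ev0 := enorm_ge0 v.
(* The chain is [mu / 2 |v|^2 <= P''(0) <= k^2 (P'(1) - P'(0)) <= k^2 (Dv v f xstar - P'(0)) <= k^2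
   W |v|]; its third inequality combines the two optimality conditions [P1] and [F0]. *)
have main : mu / 2 * enorm v ^+ 2 <= k ^+ 2 * (W * enorm v).
  apply: le_trans D3 _; apply: le_trans inc _; rewrite ler_wpM2l //.
  have := ler_wpM2r ev0 hW; lra.
rewrite -mulrA -/W.
have [->|vpos] : enorm v = 0 \/ 0 < enorm v.
- by move: ev0; rewrite le_eqVlt => /orP [/eqP <-|]; [left|right].
- by exact: mulr_ge0 (mulr_ge0 k0 (divr_ge0 (ler0n _ _) (ltW mu0))) W0.
rewrite -(ler_pM2r vpos) -(ler_pM2l (_ : 0 < mu / 2)) ?divr_gt0 // -expr2.
apply: le_trans main _; rewrite le_eqVlt; apply/orP; left; apply/eqP.
by field; rewrite gt_eqF.
Qed.

End Minimization.
End Psi.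

Unset Implicit Arguments.
Set Strict Implicit.
Set Printing Implicit Defensive.

Theorem theorem5p6 (R : realType) (n d d' m : nat)
    (hd : (2 <= d)%N)
    (hd'_even : ~~ odd d') (hd'_gt : (d < d')%N)
    (hd'_min : forall e : nat, ~~ odd e -> (d < e)%N -> (d' <= e)%N)
    (f : 'rV[R]_n -> R) (hf : Ck d f)
    (mu : R) (hmu : 0 < mu)
    (hf_mu : forall x : 'rV[R]_n, psdmx (hessian f x - mu%:M))
    (L : R) (hL : 0 < L)
    (hf_L : forall x y : 'rV[R]_n,
      tensor_norm (nabla d f y - nabla d f x) <= L * enorm (y - x))
    (g : 'I_m -> 'rV[R]_n -> R) (hg : forall i, sos_convex (g i))
    (C : set 'rV[R]_n) (hC : C = [set x | forall i, g i x <= 0])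
    (hC_int : C° !=set0)
    (xstar : 'rV[R]_n) (hxstar : unique (minimizer f C) xstar)
    (r : R)
    (hr : r = (((d - 1)`!%:R * mu) / (2 * L)) `^ ((d - 1)%:R)^-1) :
  forall x : 'rV[R]_n, enorm (x - xstar) <= r ->
    exists xplus : 'rV[R]_n,
      unique (minimizer (psi f d d' x) C) xplus /\
      enorm (xplus - xstar) <=
        (d'%:R / 2) ^+ 2 * (2 / mu) *
        (L / d`!%:R +
         set_max [set sos_coef f d d' z | z in
                    [set z : 'rV[R]_n | enorm (z - xstar) <= r]]
         * d'%:R * Num.max r 1) *
        enorm (x - xstar) ^+ d.
Proof.
move=> x xr.
have [q d'E] : exists q, d' = q.+1.*2.
  have d'3 : (3 <= d')%N by exact: leq_ltn_trans hd hd'_gt.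
  exists d'./2.-1; rewrite prednK; first by rewrite even_halfK.
  by rewrite half_gt0 ltnW.
have d'd : (d' <= d.+2)%N.
  case: (boolP (odd d)) => od; last by apply: hd'_min; rewrite //= negbK.
  by apply: leqW; apply: hd'_min; rewrite //= negbK.
have dq : (d <= (q + q).+2)%N by move: hd'_gt; rewrite d'E -addnn addSn addnS => /ltnW.
have cC : closed C.
  rewrite hC; apply: closed_forall => i; apply: closed_level_le.
    exact: continuous_sos_convex.
  exact: continuous_cst.
have convC a b t : C a -> C b -> 0 <= t <= 1 -> C (a + t *: (b - a)).
  rewrite hC => ha hb t01 i; apply: le_trans (sos_convex_quasi a b (hg i) t01) _.
  by rewrite ge_max ha hb.
have xsmin : minimizer f C xstar := hxstar.1.
have r0 : 0 <= r by rewrite hr powR_ge0.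
have d1 : (0 < d.-1)%N by rewrite -ltnS prednK // ltnW.
(* Equality holds: [r] is the radius at which the Hessian error reaches [mu / 2]. *)
have rL : L / d.-1`!%:R * r ^+ d.-1 <= mu / 2.
  rewrite hr subn1 -powR_mulrn ?powR_ge0 // -powRrM mulVf ?pnatr_eq0 -?lt0n //.
  rewrite powRr1; last by rewrite divr_ge0 ?mulr_ge0 ?(ltW hmu) ?(ltW hL).
  have fn0 : d.-1`!%:R != 0 :> R by rewrite pnatr_eq0 -lt0n fact_gt0.
  rewrite le_eqVlt; apply/orP; left; apply/eqP.
  by field; rewrite fn0 gt_eqF.
subst d'.
have [y ymin] := psi_minimizer_exists hf hd dq hmu hf_mu hf_L cC x (ex_intro _ xstar xsmin.1).
exists y; split.
  split=> // y'; exact: (psi_minimizer_unique hf hd dq hmu hf_mu hf_L convC ymin).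
have [z zr zmax] := sos_coef_max hf hd dq hmu hf_mu xstar r0.
(* The maximum is attained at [z], so [set_max] is a genuine value and dominates the coefficient at
   [x]. *)
rewrite (@set_max_eq _ _ (sos_coef f d q.+1.*2 z)); first last.
- by move=> _ [z' z'r <-]; exact: zmax.
- by exists z.
have := psi_minimizer_distance hf hd dq hmu hL hf_mu hf_L convC xr rL hd'_gt d'd xsmin ymin.
move=> /le_trans; apply.
have kE : q.+1.*2%:R / 2 = q.+1%:R :> R by rewrite -mul2n natrM mulrC mulKf ?pnatr_eq0.
have c0 : 0 <= q.+1%:R ^+ 2 * (2 / mu).
  exact: mulr_ge0 (sqr_ge0 _) (divr_ge0 (ler0n _ _) (ltW hmu)).
have max0 : 0 <= Num.max r 1 by rewrite le_max r0.
rewrite kE; apply: ler_wpM2r; first by apply: exprn_ge0; exact: enorm_ge0.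
apply: ler_wpM2l; first exact: c0.
rewrite lerD2l; apply: ler_wpM2r; first exact: max0.
apply: ler_wpM2r; first exact: ler0n.
exact: zmax.
Qed.
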